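(* Let $\ell\in\{1,2,3\}$ and $\{\ell,j,k\}=\{1,2,3\}$. Then $$Q_\ell(T)=16(T^2+e_\ell-e_j)(T^2+e_\ell-e_k),$$ where $e_i=\wp(\omega_i/2)$, $i=1,2,3$.
   Context: Let $\tau\in\mathbb{C}$ with $\mathrm{Im}\,\tau>0$, $\Lambda_\tau=\mathbb{Z}+\mathbb{Z}\tau$; $\wp,\zeta$ are the Weierstrass functions of $\Lambda_\tau$ ($\zeta'=-\wp$, $\zeta$ odd). Put $\omega_0=0,\omega_1=1,\omega_2=\tau,\omega_3=1+\tau$, $\eta_0=0$, $\eta_i=\zeta(z+\omega_i)-\zeta(z)$ for $i=1,2,3$. For $\ell\in\{1,2,3\}$ let $\varepsilon^{(\ell)}_0=\varepsilon^{(\ell)}_\ell=1$ and $\varepsilon^{(\ell)}_j=-1$ for $j\in\{1,2,3\}\setminus\{\ell\}$. For $T\in\mathbb{C}$ put $$q_\ell(z;T)=\tfrac34\sum_{k=0}^3\wp(z-\tfrac{\omega_k}{2})+T\sum_{k=0}^3\varepsilon_k^{(\ell)}\zeta(z-\tfrac{\omega_k}{2})+T^2-\eta_{3-\ell}T,$$ $$F^{(\ell)}=F^{(\ell)}(z;T)=-\sum_{k=0}^3\varepsilon_k^{(\ell)}\zeta(z-\tfrac{\omega_k}{2})+2T+\eta_{3-\ell}.$$ The spectral polynomial is $$Q_\ell(T)=\big((F^{(\ell)})'\big)^2-2(F^{(\ell)})''F^{(\ell)}+4q_\ell(z;T)(F^{(\ell)})^2,\qquad {}'=d/dz,$$ whose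 right-hand side is independent of $z$. *)

(* Defs.v *)
From mathcomp Require Import all_boot all_order all_algebra complex finmap.
From mathcomp Require Import boolp classical_sets reals topology normedtype derive.
From mathcomp Require summability.
Import Order.TTheory GRing.Theory Num.Theory.
Import numFieldNormedType.Exports.

Set Implicit Arguments.
Unset Strict Implicit.
Unset Printing Implicit Defensive.

Local Open Scope ring_scope.
Local Open Scope classical_set_scope.

(* R[i] packed as a numClosedFieldType, so that it carries the norm topology
   that MathComp-Analysis puts on every numFieldType: derivatives of functions
   Cplx R -> Cplx R are complex derivatives. *)
Definition Cplx (R : realType) : numClosedFieldType := R[i].

Section Weierstrass.
Variables (R : realType) (tau : Cplx R).
Implicit Types (z T : Cplx R) (k l : nat).

Definition latt (w : int * int) : Cplx R := w.1%:~R + w.2%:~R * tau.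

Definition Lambda : set (Cplx R) := range latt.

(* summability.sum is the unconditional sum, i.e. the limit of the finite
   partial sums along the filter of finite sets of indices. *)
Definition lattice_sum (f : Cplx R -> Cplx R) : Cplx R :=
  summability.sum (fun w : int * int => if w == 0 then 0 else f (latt w)).

Definition wp z : Cplx R :=
  z ^- 2 + lattice_sum (fun w => (z - w) ^- 2 - w ^- 2).

Definition wzeta z : Cplx R :=
  z^-1 + lattice_sum (fun w => (z - w)^-1 + w^-1 + z / w ^+ 2).

Definition omega k : Cplx R := [:: 0; 1; tau; 1 + tau]`_k.

(* get picks the unique c, whose existence is the quasi-periodicity of wzeta. *)
Definition eta k : Cplx R :=
  get [set c | forall z, ~ Lambda z -> wzeta (z + omega k) - wzeta z = c].

Definition e k : Cplx R := wp (omega k / 2).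

Definition eps l k : Cplx R := if (k == 0%N) || (k == l) then 1 else -1.

Definition q l T z : Cplx R :=
  3 / 4 * (\sum_(k < 4) wp (z - omega k / 2))
  + T * (\sum_(k < 4) eps l k * wzeta (z - omega k / 2))
  + T ^+ 2 - eta (3 - l) * T.

Definition F l T z : Cplx R :=
  - (\sum_(k < 4) eps l k * wzeta (z - omega k / 2)) + 2 * T + eta (3 - l).

(* z lies off the lattice Lambda / 2, that is, off the poles of q and F. *)
Definition regular z : Prop :=
  forall k, (k < 4)%N -> ~ Lambda (z - omega k / 2).

(* The value does not depend on the regular point z. *)
Definition spectral_poly l T z : Cplx R :=
  (derive1 (F l T) z) ^+ 2 - 2 * derive1n 2 (F l T) z * F l T z
  + 4 * q l T z * F l T z ^+ 2.

End Weierstrass.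

(* Main.v *)
Require Import Defs.
From mathcomp Require Import all_boot all_order all_algebra complex.
From mathcomp Require Import reals.
From mathcomp Require Import finmap boolp classical_sets topology normedtype.
From mathcomp Require Import derive ring lra zify.
From mathcomp Require summability.
Import Order.TTheory GRing.Theory Num.Theory.
Import numFieldNormedType.Exports.
Local Open Scope ring_scope.

(** Write [p1, p2, p3] for the half periods, [e_i] for the value of [wp] at
[p_i], [P z] for the sum of [wp (z - p)] over [p] in [{0, p1, p2, p3}], and
[sigma_l] for the alternating sum of zeta functions in [F l] with the constant
[eta (3 - l)] removed, so that [F l T = 2 T - sigma_l] and [q l T = 3/4 P + T
sigma_l + T ^ 2]. The functions [sigma_l] behave like the Jacobi functions ns,
cs, ds:

  [sigma_l ^ 2 = P - 4 e_l]   and   [sigma_l' = - sigma_j sigma_k].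

Together with [e_1 + e_2 + e_3 = 0] they turn the spectral polynomial into the
claimed product by pure algebra ([spectral_identity]).

The relations come from one identity ([zeta_diff2_sqrE]): for a half period
[c], the second difference [t z = zeta z - (zeta (z - c) + zeta (z + c)) / 2]
satisfies [t z ^ 2 = wp z + wp (z - c) + const]. Up to a factor 2, the sums and
differences of the [sigma]'s are such functions [t], taken at [z] or at a
translate of [z], so that polarization yields their squares and their products.

The identity for [t ^ 2] is usually deduced from Liouville's theorem. Here it
is proved by manipulating series, in the manner of Eisenstein. The function [t]
is the absolutely convergent sum over the lattice of [K (z - w)], where [K x =
1 / x - (1 / (x - c) + 1 / (x + c)) / 2] is of size [x ^ - 3]. Hence [t z ^ 2]
is the sum over [u] of the diagonal sums over [w] of [K (z - w) K (z - w - u)].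
By partial fractions ([diff2_invM]) a diagonal sum is a combination of
differences [zeta (z' + v) - zeta z'] with [v] in the lattice, which do not
depend on [z'], plus values of [wp] coming from the double poles; the latter
occur only for three values of [u] ([diagonal_has_sum]). So [t z ^ 2 - wp z -
wp (z - c)] is constant ([zeta_diff2_sqr]), and it is evaluated at another half
period, where [t] vanishes by parity.

Parity and quasi-periodicity of [zeta] are obtained by reindexing the series:
the sum of [f (w - v) - f w] vanishes as soon as the odd part of [f] is
summable ([telescope_has_sum]). The relation [e_1 + e_2 + e_3 = 0] follows from
sorting the lattice by residues modulo 2: this expresses [2 zeta (2 z)] as the
sum of [zeta (z - p)] plus [(e_1 + e_2 + e_3) z] plus a constant, and comparing
the increments under [z -> z + 1] kills the linear term ([half_wp_sum]).
Finally [zeta' = - wp] is the only differentiation needed ([is_derive_wzeta]),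
because [sigma_l' = - sigma_j sigma_k] gives the second derivatives for free.
*)

Set Implicit Arguments.
Unset Strict Implicit.
Unset Printing Implicit Defensive.

(** * Unconditional sums *)

Section HasSum.
Variables (K : numFieldType) (I : choiceType).
Implicit Types (f g : I -> K) (A B : {fset I}) (a b l : K).

(** Unlike the total operator [summability.sum], this asserts convergence. *)
Definition has_sum f l := forall eps, 0 < eps ->
  exists A, forall B, (A `<=` B)%fset -> `|\sum_(i <- B) f i - l| < eps.

Lemma has_sum_unique f l l' : has_sum f l -> has_sum f l' -> l = l'.
Proof.
move=> fl fl'; apply/eqP; rewrite -subr_eq0; apply/negPn/negP => ll'.
have e0 : 0 < `|l - l'| / 2 by rewrite divr_gt0// normr_gt0.
have [A HA] := fl _ e0; have [B HB] := fl' _ e0.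
have := HA _ (fsubsetUl A B); have := HB _ (fsubsetUr A B).
set S := \sum_(i <- _) _ => h1 h2.
have := ler_distD S l l'; rewrite [in leRHS](distrC l).
move=> /le_lt_trans/(_ (ltrD h2 h1)).
by rewrite -splitr ltxx.
Qed.

Lemma eq_has_sum f g l : f =1 g -> has_sum f l -> has_sum g l.
Proof. by move=> /funext ->. Qed.

Lemma has_sumD f g a b :
  has_sum f a -> has_sum g b -> has_sum (fun i => f i + g i) (a + b).
Proof.
move=> fa gb e e0; have e2 : 0 < e / 2 by rewrite divr_gt0.
have [A HA] := fa _ e2; have [B HB] := gb _ e2.
exists (A `|` B)%fset => D; rewrite fsubUset => /andP[AD BD].
rewrite big_split/= opprD addrACA (le_lt_trans (ler_normD _ _))//.
by rewrite [e]splitr ltrD ?HA ?HB.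
Qed.

Lemma has_sumZ k f a : has_sum f a -> has_sum (fun i => k * f i) (k * a).
Proof.
move=> fa e e0; have k0 : 0 < `|k| + 1 by rewrite ltr_wpDl.
have [|A HA] := fa (e / (`|k| + 1)); first by rewrite divr_gt0.
exists A => B /HA; rewrite -mulr_sumr -mulrBr normrM ltr_pdivlMr// => h.
by apply: le_lt_trans h; rewrite mulrC ler_wpM2l// lerDl.
Qed.

Lemma has_sumN f a : has_sum f a -> has_sum (fun i => - f i) (- a).
Proof.
move=> /(has_sumZ (-1)); rewrite mulN1r; apply: eq_has_sum => i.
by rewrite mulN1r.
Qed.

Lemma has_sumB f g a b :
  has_sum f a -> has_sum g b -> has_sum (fun i => f i - g i) (a - b).
Proof. by move=> fa /has_sumN; exact: has_sumD. Qed.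

Lemma has_sum_norm_le f l M : has_sum f l ->
  (forall A, `|\sum_(i <- A) f i| <= M) -> `|l| <= M.
Proof.
move=> fl fM.
have MR : M \is Num.real.
  by have := fM fset0; rewrite big_seq_fset0 normr0 => /ger0_real.
rewrite real_leNgt ?normr_real//; apply/negP => Ml.
have [|A /(_ A (fsubset_refl _)) h] := fl (`|l| - M); first by rewrite subr_gt0.
have := le_lt_trans (lerB_dist l _) (_ : `|l - \sum_(i <- A) f i| < `|l| - M).
rewrite distrC => /(_ h); rewrite ltrD2l ltrN2 => /lt_le_trans/(_ (fM A)).
by rewrite ltxx.
Qed.

Lemma has_sum_pred1 i0 a : has_sum (fun i => if i == i0 then a else 0) a.
Proof.
move=> e e0; exists [fset i0]%fset => B; rewrite fsub1set => iB.
rewrite (big_fsetD1 i0)//= eqxx big_seq big1 ?addr0 ?subrr ?normr0//.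
by move=> i; rewrite !inE => /andP[/negPf ->].
Qed.

Lemma has_sum_if (b : bool) f l :
  has_sum f l -> has_sum (fun i => if b then f i else 0) (if b then l else 0).
Proof.
case: b => // /(has_sumZ 0); rewrite mul0r; apply: eq_has_sum => i.
exact: mul0r.
Qed.

Lemma has_sumE (f : I -> K) l : has_sum f l -> summability.sum f = l.
Proof.
move=> fl; have FF := @summability.totally_filter I.
apply: cvg_lim => //; apply/(@cvgrPdist_lt K K^o) => e e0.
have [A HA] := fl _ e0; exists A => //= B /HA.
by rewrite distrC /summability.partial_sum big_seq_fsetE.
Qed.

End HasSum.

Lemma has_sum_reindex (K : numFieldType) (I J : choiceType) (h : J -> I)
    (f : I -> K) l : bijective h -> has_sum f l -> has_sum (f \o h) l.
Proof.
move=> [h' hK h'K] fl e /fl[A HA]; exists (h' @` A)%fset => B AB.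
have -> : \sum_(i <- B) (f \o h) i = \sum_(i <- (h @` B)%fset) f i.
  by rewrite big_imfset//= => x y _ _ /(can_inj hK).
apply: HA; apply/fsubsetP => x xA; apply/imfsetP; exists (h' x) => //.
by apply: (fsubsetP AB); apply/imfsetP; exists x.
Qed.

Lemma has_sum_fin (K : numFieldType) (I : finType) (f : I -> K) :
  has_sum f (\sum_i f i).
Proof.
move=> e e0; exists [fset i in enum I]%fset => B AB.
suff -> : \sum_(i <- B) f i = \sum_i f i by rewrite subrr normr0.
apply: perm_big; apply: uniq_perm; rewrite ?fset_uniq ?index_enum_uniq// => i.
by rewrite mem_index_enum; apply: (fsubsetP AB); rewrite in_fset /= mem_enum.
Qed.

Lemma big_fsetM (K : nmodType) (I J : choiceType) (A : {fset I}) (B : {fset J})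
    (F : I * J -> K) :
  \sum_(p <- (A `*` B)%fset) F p = \sum_(i <- A) \sum_(j <- B) F (i, j).
Proof.
rewrite -(big_allpairs (r1 := A) (r2 := B) (F := F)) /=.
apply: perm_big; apply: uniq_perm.
- exact: fset_uniq.
- by apply: allpairs_uniq; rewrite ?fset_uniq// => -[? ?] [? ?].
- move=> [i j]; rewrite in_fsetM /=; apply/andP/allpairsP => /=.
  + by move=> [iA jB]; exists (i, j).
  + by move=> [[x y]/= [xA yB [-> ->]]].
Qed.

(** Over a finite set of rows, the row sums are approximated by the sum over
one large finite rectangle. *)
Lemma has_sum_fubini (K : numFieldType) (I J : choiceType) (F : I * J -> K)
    (g : I -> K) l : has_sum F l ->
  (forall i, has_sum (fun j => F (i, j)) (g i)) -> has_sum g l.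
Proof.
move=> Fl Fg e e0; have e2 : 0 < e / 2 by rewrite divr_gt0.
have [A HA] := Fl _ e2; exists (fst @` A)%fset => B AB.
(* the error [e / 2] is shared among the rows indexed by [B] *)
have k0 : 0 < (#|` B|.+1%:R : K) by rewrite ltr0n.
have /choice[D HD] i := Fg i _ (divr_gt0 e2 k0).
pose C := (snd @` A `|` \bigcup_(i <- B) D i)%fset.
have AC : (A `<=` B `*` C)%fset.
  apply/fsubsetP => p pA; rewrite in_fsetM (fsubsetP AB)/= ?in_imfset//.
  by rewrite in_fsetU in_imfset.
have /ltW h1 : `|\sum_(i <- B) g i - \sum_(p <- (B `*` C)%fset) F p| < e / 2.
  rewrite big_fsetM -sumrB (le_lt_trans (ler_norm_sum _ _ _))//.
  have -> : e / 2 = e / 2 / #|` B|.+1%:R * #|` B|.+1%:R.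
    by rewrite divfK// gt_eqF.
  apply: (@le_lt_trans _ _ (\sum_(i <- B) (e / 2 / #|` B|.+1%:R))).
    rewrite big_seq [leRHS]big_seq; apply: ler_sum => i iB.
    rewrite distrC ltW// HD//; apply: fsubset_trans (fsubsetUr _ _).
    exact: bigfcup_sup.
  rewrite big_const_seq count_predT iter_addr_0 -[ltLHS]mulr_natr.
  by rewrite ltr_pM2l ?ltr_nat// divr_gt0.
apply: le_lt_trans (ler_distD (\sum_(p <- (B `*` C)%fset) F p) _ _) _.
by rewrite [ltRHS]splitr ler_ltD// HA.
Qed.

Lemma ler_sum_fset (K : numDomainType) (I : choiceType) (g : I -> K)
    (A B : {fset I}) : (forall i, 0 <= g i) -> (A `<=` B)%fset ->
  \sum_(i <- A) g i <= \sum_(i <- B) g i.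
Proof.
move=> g0 AB; rewrite [leRHS](big_fsetID _ (mem A)) /=.
suff -> : [fset x in B | x \in A]%fset = A by rewrite lerDl sumr_ge0.
apply/fsetP => x; rewrite !inE /= andbC; apply: andb_idr; exact: fsubsetP.
Qed.

Lemma has_sum_real (R : realType) (I : choiceType) (g : I -> R) M :
  (forall i, 0 <= g i) -> (forall A : {fset I}, \sum_(i <- A) g i <= M) ->
  exists l, has_sum g l.
Proof.
move=> g0 gM.
pose E := [set x | exists A : {fset I}, x = \sum_(i <- A) g i]%classic.
have hsE : has_sup E.
  by split; [exists 0, fset0; rewrite big_seq_fset0 | exists M => _ [A ->]].
exists (sup E) => e e0; have [_ [A ->] HA] := sup_adherent e0 hsE.
exists A => B AB; rewrite distrC ger0_norm ?subr_ge0.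
  by rewrite ltrBlDl -ltrBlDr (lt_le_trans HA)// ler_sum_fset.
by apply: ub_le_sup; [case: hsE | exists B].
Qed.

Lemma normc_ge_Im (R : rcfType) (x : R[i]) :
  real_complex R `|complex.Im x| <= `|x|.
Proof. by rewrite normc_def lecR -sqrtr_sqr ler_wsqrtr// lerDr sqr_ge0. Qed.

Section Complex.
Variables (R : realType) (I : choiceType).
Local Notation C := (Cplx R).
Implicit Types f : I -> C.

Lemma has_sum_RtoC (g : I -> R) l : has_sum g l ->
  has_sum (fun i => (real_complex R (g i) : C)) (real_complex R l : C).
Proof.
move=> gl e e0; have er : e = real_complex R (complex.Re e) :> C.
  by rewrite RRe_real // gtr0_real.
have [|A HA] := gl (complex.Re e); first by rewrite -ltcR -er.
exists A => B /HA; rewrite -rmorph_sum -rmorphB er.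
by rewrite normc_def /= expr0n addr0 sqrtr_sqr ltcR.
Qed.

(** Completeness of the reals is applied to the real and the imaginary part,
each of which is a difference of two nonnegative families with bounded partial
sums. *)
Lemma has_sum_complex f (M : C) :
  (forall A : {fset I}, \sum_(i <- A) `|f i| <= M) -> exists l, has_sum f l.
Proof.
move=> fM.
pose n i := complex.Re (`|f i| : R[i]).
have nE i : `|f i| = real_complex R (n i) :> C.
  by rewrite RRe_real // normr_real.
have nM (A : {fset I}) : \sum_(i <- A) n i <= complex.Re M.
  have := fM A; under eq_bigr do rewrite nE.
  by rewrite -rmorph_sum lecE /= => /andP[].
have part (g : I -> R) : (forall i, `|g i| <= n i) -> exists l, has_sum g l.
  move=> gn; have ng i : - n i <= g i <= n i by rewrite -ler_norml.
  have [l1 h1] : exists l, has_sum n l.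
    apply: has_sum_real nM => i; exact: le_trans (gn i).
  have [l2 h2] : exists l, has_sum (fun i => g i + n i) l.
    apply: (@has_sum_real _ _ _ (complex.Re M * 2)) => [i|A].
      by have := ng i; lra.
    apply: (@le_trans _ _ (\sum_(i <- A) (n i * 2))); last first.
      by rewrite -mulr_suml ler_wpM2r.
    by apply: ler_sum => i _; have := ng i; lra.
  exists (l2 - l1); apply: eq_has_sum (has_sumB h2 h1) => i.
  by rewrite addrK.
have [lr hr] : exists l, has_sum (fun i => complex.Re (f i : R[i])) l.
  by apply: part => i; rewrite -lecR -nE; exact: normc_ge_Re.
have [li hi] : exists l, has_sum (fun i => complex.Im (f i : R[i])) l.
  by apply: part => i; rewrite -lecR -nE; exact: normc_ge_Im.
exists (real_complex R lr + 'i%C * real_complex R li).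
apply: eq_has_sum (has_sumD (has_sum_RtoC hr)
  (has_sumZ ('i%C : C) (has_sum_RtoC hi))).
by move=> i; rewrite -complexE.
Qed.

End Complex.

(** * Sums over pairs of integers with cubic decay *)

Definition weight (w : int * int) : nat := (`|w.1| + `|w.2|).+1.

Section WeightSum.
Variable K : numFieldType.

(** Telescoping: [1 / (b + 1) ^ 2 <= 2 / (b + 1) - 2 / (b + 2)]. *)
Lemma sum_inv_sqr_le (a N : nat) :
  \sum_(0 <= n < N) ((a + n).+1%:R ^- 2 : K) <= 2 / a.+1%:R.
Proof.
suff : \sum_(0 <= n < N) ((a + n).+1%:R ^- 2 : K)
    <= 2 / a.+1%:R - 2 / (a + N).+1%:R.
  by move/le_trans; apply; rewrite gerBl divr_ge0.
elim: N => [|N IH]; first by rewrite big_geq// addn0 subrr.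
rewrite big_nat_recr//= (le_trans (lerD IH (lexx _)))// addnS.
set b := (a + N)%N.
rewrite -addrA lerD2l -subr_ge0.
have b1 : (b.+1%:R : K) != 0 by rewrite pnatr_eq0.
have b2 : (b.+2%:R : K) != 0 by rewrite pnatr_eq0.
have -> : - (2 / b.+2%:R) - (- (2 / b.+1%:R) + b.+1%:R ^- 2) =
    b%:R / (b.+1%:R ^+ 2 * b.+2%:R) :> K.
  have e1 : (b.+1%:R : K) = b%:R + 1 by rewrite -natr1.
  have e2 : (b.+2%:R : K) = b%:R + 2 by rewrite -(natrD _ b 2) addn2.
  by move: b1 b2; rewrite e1 e2 => b1 b2; field; rewrite b1 b2.
by rewrite divr_ge0// mulr_ge0// ?exprn_ge0.
Qed.

Definition int_range (N : nat) : seq int :=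
  [seq Posz n | n <- iota 0 N] ++ [seq Negz n | n <- iota 0 N].

Lemma int_range_uniq N : uniq (int_range N).
Proof.
rewrite cat_uniq !map_inj_uniq ?iota_uniq/=; [|by move=> ? ? []..].
by rewrite andbT -all_predC; apply/allP => x /mapP[n _ ->]; apply/mapP => -[].
Qed.

Lemma mem_int_range N (x : int) : (`|x| < N)%N -> x \in int_range N.
Proof.
rewrite mem_cat => xN; apply/orP; case: x xN => n /= nN.
  by left; apply/mapP; exists n; rewrite ?mem_iota.
by right; apply/mapP; exists n; rewrite ?mem_iota//= ltnW.
Qed.

Lemma sum_int_inv_sqr_le (a : nat) (S : {fset int}) :
  \sum_(x <- S) ((a + `|x|).+1%:R ^- 2 : K) <= 4 / a.+1%:R.
Proof.
pose N := (\max_(x <- S) `|x|%N).+1.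
have SN : (S `<=` [fset x in int_range N])%fset.
  apply/fsubsetP => x xS; rewrite in_fset; apply: mem_int_range; rewrite ltnS.
  exact: leq_bigmax_seq.
have ge0 (x : int) : 0 <= ((a + `|x|).+1%:R ^- 2 : K).
  by rewrite invr_ge0 exprn_ge0.
rewrite (le_trans (ler_sum_fset ge0 SN))//.
rewrite (perm_big (int_range N)); last first.
  apply: uniq_perm; rewrite ?fset_uniq ?int_range_uniq// => x.
  by rewrite in_fset.
have -> : 4 / a.+1%:R = 2 / a.+1%:R + 2 / a.+1%:R :> K.
  by rewrite -mulrDl -natrD.
rewrite /int_range big_cat !big_map lerD//; have := sum_inv_sqr_le a N.
  by rewrite /index_iota subn0.
apply: le_trans; rewrite /index_iota subn0; apply: ler_sum => n _.
by rewrite lef_pV2 ?posrE ?exprn_gt0// lerXn2r ?nnegrE// ler_nat; lia.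
Qed.

(** For a fixed first coordinate [x], one factor of the weight is bounded below
by [1 + |x|]; summing the other two over the second coordinate leaves [4 / (1 +
|x|) ^ 2], which is summed over [x] in turn. *)
Lemma sum_weight_le (A : {fset int * int}) :
  \sum_(w <- A) ((weight w)%:R ^- 3 : K) <= 16.
Proof.
have AP : (A `<=` (fst @` A) `*` (snd @` A))%fset.
  by apply/fsubsetP => w wA; rewrite in_fsetM !in_imfset.
rewrite (le_trans (ler_sum_fset _ AP))// => [w|].
  by rewrite invr_ge0 exprn_ge0.
rewrite big_fsetM (@le_trans _ _
    (\sum_(x <- (fst @` A)%fset) 4 * ((0 + `|x|).+1%:R ^- 2)))//; last first.
  rewrite -mulr_sumr (le_trans (ler_wpM2l _ (sum_int_inv_sqr_le _ _)))//.
  by rewrite divr1 -natrM.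
apply: ler_sum => x _; rewrite add0n.
have x0 : 0 <= ((`|x|).+1%:R : K)^-1 by rewrite invr_ge0.
apply: (@le_trans _ _ ((`|x|).+1%:R^-1 * (4 / (`|x|).+1%:R))); last first.
  by rewrite mulrCA -expr2 exprVn.
apply: (le_trans _ (ler_wpM2l x0 (sum_int_inv_sqr_le _ (snd @` A)%fset))).
rewrite mulr_sumr; apply: ler_sum => y _; rewrite /weight/=.
rewrite -!exprVn exprS ler_wpM2r ?exprn_ge0 ?invr_ge0//.
by rewrite lef_pV2 ?posrE// ler_nat ltnS leq_addr.
Qed.

End WeightSum.

Section Decay.
Variable R : realType.
Local Notation C := (Cplx R).
Implicit Types f g : int * int -> C.

Definition decay n f :=
  exists c : C, forall w, `|f w| <= c * (weight w)%:R ^- n.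

Lemma eq_decay n f g : f =1 g -> decay n f -> decay n g.
Proof. by move=> /funext ->. Qed.

Lemma decayD n f g : decay n f -> decay n g -> decay n (fun w => f w + g w).
Proof.
move=> [a fa] [b gb]; exists (a + b) => w.
by rewrite (le_trans (ler_normD _ _))// mulrDl lerD.
Qed.

Lemma decayZ n k f : decay n f -> decay n (fun w => k * f w).
Proof.
by move=> [a fa]; exists (`|k| * a) => w; rewrite normrM -mulrA ler_wpM2l.
Qed.

Lemma decayM m n f g :
  decay m f -> decay n g -> decay (m + n) (fun w => f w * g w).
Proof.
move=> [a fa] [b gb]; exists (a * b) => w.
by rewrite normrM exprD invfM mulrACA ler_pM.
Qed.

Lemma decay_pred1 n k : decay n (fun w => if w == 0 then k else 0).
Proof.
exists `|k| => w; case: eqP => [->|_]; first by rewrite expr1n invr1 mulr1.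
by rewrite normr0 mulr_ge0// invr_ge0 exprn_ge0.
Qed.

Lemma decay_partial_sum f : decay 3 f ->
  exists M : C, forall A : {fset int * int}, \sum_(w <- A) `|f w| <= M.
Proof.
move=> [c fc]; have c0 : 0 <= c.
  by have := fc 0; rewrite expr1n invr1 mulr1; apply: le_trans.
exists (c * 16) => A; rewrite (le_trans (ler_sum _ (fun w _ => fc w)))//.
by rewrite -mulr_sumr ler_wpM2l// sum_weight_le.
Qed.

Lemma decay_has_sum f : decay 3 f -> exists l, has_sum f l.
Proof. by move=> /decay_partial_sum[M fM]; exact: has_sum_complex fM. Qed.

(** Absolute convergence is used only for the existence of the sum over all
pairs; its value is then read off the rows. *)
Lemma has_sum_sqr f a : decay 3 f -> has_sum f a ->
  has_sum (fun p : (int * int) * (int * int) => f p.1 * f p.2) (a * a).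
Proof.
move=> /decay_partial_sum[M fM] fa.
have [A|l fl] := @has_sum_complex _ _
    (fun p : (int * int) * (int * int) => f p.1 * f p.2) (M * M).
  have AP : (A `<=` (fst @` A) `*` (snd @` A))%fset.
    by apply/fsubsetP => w wA; rewrite in_fsetM !in_imfset.
  rewrite (le_trans (ler_sum_fset _ AP))//.
  rewrite big_fsetM; under eq_bigr do under eq_bigr do rewrite /= normrM.
  under eq_bigr do rewrite -mulr_sumr; rewrite -mulr_suml.
  by apply: ler_pM => //; apply: sumr_ge0.
suff : has_sum (fun v => f v * a) l.
  have : has_sum (fun v => f v * a) (a * a).
    by apply: eq_has_sum (has_sumZ a fa) => v; rewrite mulrC.
  by move=> h1 h2; rewrite (has_sum_unique h1 h2).
by apply: (has_sum_fubini fl) => v; exact: (has_sumZ (f v) fa).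
Qed.

End Decay.

(** * The lattice *)

Section Lattice.
Variables (R : realType) (tau : Cplx R).
Hypothesis htau : 0 < complex.Im tau.
Local Notation C := (Cplx R).
Local Notation latt := (latt tau).
Local Notation Lambda := (Lambda tau).
Implicit Types (v w : int * int) (z x c d : C).

Lemma latt0 : latt 0 = 0.
Proof. by rewrite /Defs.latt mul0r addr0. Qed.

Lemma lattN w : latt (- w) = - latt w.
Proof. by rewrite /Defs.latt /= !rmorphN /= mulNr opprD. Qed.

Lemma lattD v w : latt (v + w) = latt v + latt w.
Proof. by rewrite /Defs.latt /= !rmorphD /= mulrDl addrACA. Qed.

Lemma lattB v w : latt (v - w) = latt v - latt w.
Proof. by rewrite lattD lattN. Qed.

Lemma normr_intr (n : int) : `|n%:~R : C| = `|n|%N%:R.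
Proof. by rewrite -intr_norm natr_absz. Qed.

(** The imaginary part of [m + n tau] bounds [n], and then the triangle
inequality bounds [m]. *)
Lemma latt_lower : exists2 k : C, 0 < k &
  forall w, k * (`|w.1| + `|w.2|)%N%:R <= `|latt w|.
Proof.
pose y : C := real_complex R (complex.Im tau).
have y0 : 0 < y by rewrite ltcR.
have h w : `|w.2|%N%:R * y <= `|latt w|.
  suff -> : `|w.2|%N%:R * y = real_complex R `|complex.Im (latt w)|.
    exact: normc_ge_Im.
  have -> : complex.Im (latt w) = w.2%:~R * complex.Im tau.
    rewrite /Defs.latt; case: (tau) => a b /=.
    rewrite -!(rmorph_int (real_complex R)) /=; simpc.
    by rewrite /= ?add0r ?addr0.
  by rewrite normrM rmorphM (gtr0_norm htau) -intr_norm rmorph_int natr_absz.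
have D0 : 0 < 1 + y + `|tau| by rewrite ltr_wpDr// addr_gt0.
exists (y / (1 + y + `|tau|)); first by rewrite divr_gt0.
move=> w; rewrite mulrAC ler_pdivrMr// natrD.
have m_le : `|w.1|%N%:R <= `|latt w| + `|w.2|%N%:R * `|tau|.
  rewrite -!normr_intr -normrM; have := ler_normB (latt w) (w.2%:~R * tau).
  by rewrite addrK.
have {}m_le := ler_wpM2r (ltW y0) m_le.
rewrite mulrC mulrDl (le_trans (lerD m_le (h w)))//.
rewrite -subr_ge0.
set L := `|latt w|; set N := `|w.2|%N%:R.
have -> : L * (1 + y + `|tau|) - ((L + N * `|tau|) * y + L) =
  `|tau| * (L - N * y) by ring.
by rewrite mulr_ge0// subr_ge0; exact: h.
Qed.

Lemma latt_lower_weight : exists2 k : C, 0 < k &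
  forall w, w != 0 -> k * (weight w)%:R <= `|latt w|.
Proof.
have [k k0 kP] := latt_lower; exists (k / 2); first by rewrite divr_gt0.
move=> [m n] mn0; apply: le_trans (kP _); rewrite -mulrA ler_pM2l//.
rewrite ler_pdivrMl// -natrM ler_nat /weight/=.
suff : (0 < `|m| + `|n|)%N by lia.
rewrite lt0n addn_eq0 !absz_eq0; apply: contra mn0 => /andP[/eqP-> /eqP->].
by [].
Qed.

Lemma latt_eq0 w : latt w = 0 -> w = 0.
Proof.
have [k k0 kP] := latt_lower_weight => lw; apply/eqP/negPn/negP => /kP.
have : 0 < k * (weight w)%:R by rewrite mulr_gt0// ltr0n.
by rewrite lw normr0 => /lt_le_trans h /h; rewrite ltxx.
Qed.

Lemma latt_inj : injective latt.
Proof.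
by move=> v w vw; apply/eqP; rewrite -subr_eq0; apply/eqP/latt_eq0;
  rewrite lattB vw subrr.
Qed.

Lemma LambdaN z : Lambda z -> Lambda (- z).
Proof. by move=> [w _ <-]; exists (- w) => //; rewrite lattN. Qed.

Lemma LambdaDr z w : Lambda (z + latt w) <-> Lambda z.
Proof.
split=> [[v _ vE]|[v _ <-]]; last by exists (v + w) => //; rewrite lattD.
by exists (v - w) => //; rewrite lattB vE addrK.
Qed.

Lemma subr_latt_neq0 z w : ~ Lambda z -> z - latt w != 0.
Proof.
by move=> zL; apply/negP; rewrite subr_eq0 => /eqP zE; apply: zL; exists w.
Qed.

(** Discreteness gives a positive lower bound [d] for the distance of [z] to
the lattice; since [`|z - latt w|] is at least [k (|m| + |n|) - |z|], adding a
multiple of [d] absorbs the constant [|z|]. *)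
Lemma off_lattice z : ~ Lambda z -> exists2 k : C, 0 < k &
  forall w, k * (weight w)%:R <= `|z - latt w|.
Proof.
move=> zL; have [k k0 kP] := latt_lower.
have lower w : k * (`|w.1| + `|w.2|)%N%:R - `|z| <= `|z - latt w|.
  by rewrite distrC (le_trans _ (lerB_dist _ _))// lerD2r.
have [d d0 dP] : exists2 d : C, 0 < d & forall w, d <= `|z - latt w|.
  pose b : C := (`|z| + 1) / k.
  have b0 : 0 <= b by rewrite divr_ge0 ?addr_ge0// ltW.
  pose N := Num.bound (complex.Re (b : R[i])).
  have bN : b < N%:R.
    rewrite -(RRe_real (ger0_real b0)) -(rmorph_nat (real_complex R)) ltcR.
    by apply: archi_boundP; rewrite -ler0c RRe_real ?ger0_real.
  (* [(1 + S)^-1] is below 1 and below [`|z - latt w|] for [w] in the box *)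
  pose S : C := \sum_(w <- allpairs pair (int_range N) (int_range N))
    `|z - latt w|^-1.
  have S0 : 0 <= S by apply: sumr_ge0 => w _; rewrite invr_ge0.
  have S1 : 0 < 1 + S by rewrite ltr_wpDr.
  exists (1 + S)^-1; first by rewrite invr_gt0.
  move=> w; have zw : 0 < `|z - latt w| by rewrite normr_gt0 subr_latt_neq0.
  have [wN|wN] := ltnP (`|w.1| + `|w.2|) N.
    rewrite -[leRHS]invrK lef_pV2 ?posrE ?invr_gt0//.
    have wS : w \in allpairs pair (int_range N) (int_range N).
      apply/allpairsP; exists w; rewrite -surjective_pairing.
      by split=> //; apply: mem_int_range; apply: leq_ltn_trans wN;
        rewrite ?leq_addr ?leq_addl.
    rewrite /S (big_rem _ wS)/= addrCA lerDl addr_ge0// sumr_ge0// => v _.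
    by rewrite invr_ge0.
  apply: le_trans (lower w); apply: (@le_trans _ _ 1).
    by rewrite invf_le1// lerDl.
  rewrite lerBrDr addrC.
  have -> : `|z| + 1 = k * b by rewrite mulrC divfK// gt_eqF.
  by rewrite ler_pM2l// (le_trans (ltW bN))// ler_nat.
have zkd : 0 <= (`|z| + k) / d by rewrite ltW// divr_gt0// ltr_wpDl.
have q0 : 0 < 1 + (`|z| + k) / d by rewrite ltr_wpDr.
exists (k / (1 + (`|z| + k) / d)); first by rewrite divr_gt0.
move=> w; rewrite mulrAC ler_pdivrMr// mulrDr mulr1.
have -> : k * (weight w)%:R =
    (k * (`|w.1| + `|w.2|)%N%:R - `|z|) + d * ((`|z| + k) / d).
  rewrite /weight -natr1 mulrDr mulr1 [d * _]mulrC divfK ?gt_eqF//.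
  by rewrite -addrA addKr.
by rewrite lerD// ler_wpM2r.
Qed.

End Lattice.

(** * The series of zeta and of wp *)

Section Functions.
Variables (R : realType) (tau : Cplx R).
Hypothesis htau : 0 < complex.Im tau.
Local Notation C := (Cplx R).
Local Notation latt := (latt tau).
Local Notation Lambda := (Lambda tau).
Local Notation wp := (wp tau).
Local Notation wzeta := (wzeta tau).
Implicit Types (v w : int * int) (z x c d : C).

(** With the convention [0^-1 = 0], these terms take at [x = 0] the values of
the isolated first summands of [wzeta] and [wp], so that the series run over
the whole lattice. *)
Definition zeta_term z x : C := (z - x)^-1 + x^-1 + z / x ^+ 2.
Definition wp_term z x : C := (z - x) ^- 2 - x ^- 2.

Lemma decay_inv_sub z : ~ Lambda z -> decay 1 (fun w => (z - latt w)^-1).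
Proof.
move=> zL; have [a a0 aP] := off_lattice htau zL; exists a^-1 => w.
rewrite expr1 normfV -invfM lef_pV2 ?aP// posrE.
  by rewrite normr_gt0 subr_latt_neq0.
by rewrite mulr_gt0// ltr0n.
Qed.

Lemma decay_inv_latt : decay 1 (fun w => (latt w)^-1).
Proof.
have [b b0 bP] := latt_lower_weight htau; exists b^-1 => w.
have bw0 : 0 < b * (weight w)%:R by rewrite mulr_gt0// ltr0n.
rewrite expr1 normfV -invfM; have [->|w0] := eqVneq w 0.
  by rewrite latt0 normr0 invr0 invr_ge0 mulr_ge0// ltW.
by rewrite lef_pV2 ?bP// posrE ?(lt_le_trans bw0 (bP w w0)).
Qed.

Lemma decay_zeta z : ~ Lambda z -> decay 3 (fun w => zeta_term z (latt w)).
Proof.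
move=> zL; have dz := decay_inv_sub zL; have d0 := decay_inv_latt.
apply: eq_decay (decayD (decayZ (z ^+ 2) (decayM dz (decayM d0 d0)))
  (decay_pred1 3 z^-1)) => w /=.
have [->|w0] := eqVneq w 0.
  by rewrite latt0 /zeta_term subr0 expr0n invr0 !mulr0 add0r !addr0.
have zx : z - latt w != 0 by exact: subr_latt_neq0.
have x0 : latt w != 0 by apply: contra w0 => /eqP/(latt_eq0 htau)/eqP.
by rewrite /zeta_term; field; rewrite zx x0.
Qed.

Lemma decay_wp z : ~ Lambda z -> decay 3 (fun w => wp_term z (latt w)).
Proof.
move=> zL; have dz := decay_inv_sub zL; have d0 := decay_inv_latt.
apply: eq_decay (decayD (decayD (decayZ z (decayM dz (decayM dz d0)))
  (decayZ (- z) (decayM dz (decayM d0 d0)))) (decay_pred1 3 (z ^- 2))) => w /=.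
have [->|w0] := eqVneq w 0.
  by rewrite latt0 /wp_term subr0 expr0n invr0 !mulr0 !add0r subr0.
have zx : z - latt w != 0 by exact: subr_latt_neq0.
have x0 : latt w != 0 by apply: contra w0 => /eqP/(latt_eq0 htau)/eqP.
by rewrite /wp_term; field; rewrite zx x0.
Qed.

Lemma wzeta_has_sum z : ~ Lambda z ->
  has_sum (fun w => zeta_term z (latt w)) (wzeta z).
Proof.
move=> /decay_zeta/decay_has_sum[l zl].
suff -> : wzeta z = l by [].
have := has_sumE (eq_has_sum _ (has_sumB zl (has_sum_pred1 0 z^-1))).
rewrite /Defs.wzeta /lattice_sum => ->; first by rewrite addrC subrK.
move=> w /=; case: eqP => [->|_]; last by rewrite subr0.
rewrite latt0 /zeta_term subr0 invr0 addr0 expr0n invr0 mulr0 addr0.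
by rewrite subrr.
Qed.

Lemma wp_has_sum z : ~ Lambda z ->
  has_sum (fun w => wp_term z (latt w)) (wp z).
Proof.
move=> /decay_wp/decay_has_sum[l zl].
suff -> : wp z = l by [].
have := has_sumE (eq_has_sum _ (has_sumB zl (has_sum_pred1 0 (z ^- 2)))).
rewrite /Defs.wp /lattice_sum => ->; first by rewrite addrC subrK.
move=> w /=; case: eqP => [->|_]; last by rewrite subr0.
by rewrite latt0 /wp_term subr0 expr0n invr0 subr0 subrr.
Qed.

Let opp_bij : bijective (-%R : int * int -> int * int).
Proof. exact: inv_bij opprK. Qed.

Lemma wzetaN z : ~ Lambda z -> wzeta (- z) = - wzeta z.
Proof.
move=> zL; have nzL : ~ Lambda (- z) by move=> /LambdaN; rewrite opprK.
apply: (has_sum_unique (wzeta_has_sum nzL)).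
apply: eq_has_sum (has_sumN (has_sum_reindex opp_bij (wzeta_has_sum zL))).
move=> w /=.
rewrite lattN /zeta_term sqrrN opprK.
by rewrite -[- z - latt w]opprD !invrN; ring.
Qed.

Lemma wpN z : ~ Lambda z -> wp (- z) = wp z.
Proof.
move=> zL; have nzL : ~ Lambda (- z) by move=> /LambdaN; rewrite opprK.
apply: (has_sum_unique (wp_has_sum nzL)).
apply: eq_has_sum (has_sum_reindex opp_bij (wp_has_sum zL)) => w /=.
by rewrite lattN /wp_term sqrrN opprK -[- z - latt w]opprD sqrrN.
Qed.

(** The family [f] itself need not be summable. The reflection [w -> v - w]
turns the sum into that of [f (- w) - f (v - w)]; adding both leaves the
increments of the odd part [f w - f (- w)], which is summable and hence has
zero total increment. *)
Lemma telescope_has_sum (f : int * int -> C) (v : int * int) S o :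
  has_sum (fun w => f (w - v) - f w) S ->
  has_sum (fun w => f w - f (- w)) o -> S = 0.
Proof.
move=> fS fo.
have sub_bij : bijective (fun w : int * int => v - w).
  by exists (fun w => v - w) => w; rewrite opprB addrC subrK.
have shift_bij : bijective (fun w : int * int => w - v).
  by exists (fun w => w + v) => w; rewrite ?addrK ?subrK.
have h1 := has_sumD fS (has_sum_reindex sub_bij fS).
have h2 := has_sumB (has_sum_reindex shift_bij fo) fo.
have : S + S = o - o.
  apply: has_sum_unique h1 _; apply: eq_has_sum h2 => w /=.
  have -> : v - w - v = - w by rewrite addrC addrA addNr add0r.
  by rewrite opprB; ring.
by rewrite subrr -mulr2n => /eqP; rewrite mulrn_eq0/= => /eqP.
Qed.

Lemma wpD_latt z v : ~ Lambda z -> wp (z + latt v) = wp z.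
Proof.
move=> zL; have zvL : ~ Lambda (z + latt v) by move=> /LambdaDr.
apply/eqP; rewrite -subr_eq0; apply/eqP.
apply: (@telescope_has_sum (fun w => (z - latt w) ^- 2) v).
  apply: eq_has_sum (has_sumB (wp_has_sum zvL) (wp_has_sum zL)) => w /=.
  rewrite /wp_term lattB.
  have -> : z - (latt w - latt v) = z + latt v - latt w by ring.
  by ring.
apply: eq_has_sum (has_sumB (wp_has_sum zL)
  (has_sum_reindex opp_bij (wp_has_sum zL))) => w /=.
by rewrite /wp_term lattN sqrrN; ring.
Qed.

(** Comparing two points [z] and [z'] replaces [(z - w)^-1], whose odd part is
not summable, by the difference [(z - w)^-1 - (z' - w)^-1]. *)
Lemma wzeta_shift z z' v : ~ Lambda z -> ~ Lambda z' ->
  wzeta (z + latt v) - wzeta z = wzeta (z' + latt v) - wzeta z'.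
Proof.
move=> zL zL'; have zvL : ~ Lambda (z + latt v) by move=> /LambdaDr.
have zvL' : ~ Lambda (z' + latt v) by move=> /LambdaDr.
apply/eqP; rewrite -subr_eq0; apply/eqP.
apply: (@telescope_has_sum (fun w => (z - latt w)^-1 - (z' - latt w)^-1) v).
  apply: eq_has_sum (has_sumB (has_sumB (wzeta_has_sum zvL) (wzeta_has_sum zL))
    (has_sumB (wzeta_has_sum zvL') (wzeta_has_sum zL'))) => w /=.
  rewrite /zeta_term lattB.
  have -> : z - (latt w - latt v) = z + latt v - latt w by ring.
  have -> : z' - (latt w - latt v) = z' + latt v - latt w by ring.
  by ring.
have h := has_sumB (wzeta_has_sum zL) (wzeta_has_sum zL').
apply: eq_has_sum (has_sumB h (has_sum_reindex opp_bij h)) => w /=.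
by rewrite /zeta_term lattN sqrrN invrN; ring.
Qed.

End Functions.

(** * The square of the second difference of zeta *)

Section PartialFractions.
Variable K : numFieldType.
Implicit Types c x u y : K.

Definition diff2_inv c x : K := x^-1 - ((x - c)^-1 + (x + c)^-1) / 2.

(** The six simple poles are paired as [u, 0], [u + c, - c] and [u - c, c],
whose differences are lattice vectors when [u] and [c + c] are. Each bracket
becomes, for [x = z - w] and [y = w ^- 2], the [w]-th term of a difference
[zeta (z' + v) - zeta z']. The total coefficient of [y] is zero because the
left side is of size [x ^- 6]. When [u] is [0], [c + c] or [- (c + c)], some
poles collide: a bracket whose two poles merge vanishes, the convention [0^-1 =
0] removes the infinite parts of the residues, and the last three summands are
the double poles. *)
Lemma diff2_invM c x u y : c != 0 ->
  x != 0 -> x - c != 0 -> x + c != 0 ->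
  x - u != 0 -> x - u - c != 0 -> x - u + c != 0 ->
  u - c != 0 -> u + c != 0 ->
  diff2_inv c x * diff2_inv c (x - u) =
    diff2_inv c u * ((x - u)^-1 - x^-1 - u * y)
    - diff2_inv c (u + c) / 2 * ((x - u - c)^-1 - (x + c)^-1 - (u + c + c) * y)
    - diff2_inv c (u - c) / 2 * ((x - u + c)^-1 - (x - c)^-1 - (u - c - c) * y)
    + (if u == 0 then
         x ^- 2 - y + ((x - c) ^- 2 - y) / 4 + ((x + c) ^- 2 - y) / 4 else 0)
    + (if u == c + c then ((x - c) ^- 2 - y) / 4 else 0)
    + (if u == - (c + c) then ((x + c) ^- 2 - y) / 4 else 0).
Proof.
move=> c0 x0 xc0 xc0' xu0 xuc0 xuc0' uc0 uc0'.
have c2 : c + c != 0 by rewrite -mulr2n mulrn_eq0.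
have c3 : c + c + c != 0.
  by have := mulrn_eq0 c 3; rewrite (negPf c0) mulrS mulr2n addrA => ->.
have c4 : c + c + (c + c) != 0 by rewrite -mulr2n mulrn_eq0.
rewrite /diff2_inv.
have [u0|u0] := eqVneq u 0.
  rewrite u0 eq_sym (negPf c2) eq_sym oppr_eq0 (negPf c2).
  rewrite !addr0 !subr0 !sub0r !add0r.
  rewrite !subrr addNr invr0; field.
  by rewrite -opprD oppr_eq0 x0 xc0 xc0' c0 c2.
have [uE|u2] := eqVneq u (c + c).
  rewrite uE in xu0 xuc0 xuc0' *; rewrite -addr_eq0 (negPf c4) !addrK !subrr.
  rewrite invr0; field.
  by rewrite xu0 xuc0 x0 xc0 xc0' c0 c2 c3 -addrA c4.
have [uE|u2'] := eqVneq u (- (c + c)).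
  have e1 : - (c + c) + c = - c by ring.
  have e2 : - (c + c) - c = - (c + c + c) by ring.
  have e3 : - (c + c + c) - c = - (c + c + (c + c)) by ring.
  have e4 : - c - c = - (c + c) by ring.
  have e5 : - (c + c + c) + c = - (c + c) by ring.
  rewrite uE opprK in xu0 xuc0 xuc0' *.
  rewrite !(e1, e2, e3, e4, e5) addNr !invrN invr0; field.
  by rewrite ?(xu0, xuc0, xuc0', x0, xc0, xc0', c0, c2, c3, c4).
rewrite addrK subrK !addr0; field.
have u2c : u - c - c != 0 by rewrite -addrA -opprD subr_eq0.
have u2c' : u + c + c != 0 by rewrite -addrA -[c + c]opprK subr_eq0.
by rewrite u0 uc0 uc0' u2c u2c' x0 xc0 xc0' xu0 xuc0 xuc0'.
Qed.

End PartialFractions.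

Lemma double_int_neq1 (m : int) : m + m <> 1.
Proof. lia. Qed.

Section Squares.
Variables (R : realType) (tau : Cplx R).
Hypothesis htau : 0 < complex.Im tau.
Local Notation C := (Cplx R).
Local Notation latt := (latt tau).
Local Notation Lambda := (Lambda tau).
Local Notation wp := (wp tau).
Local Notation wzeta := (wzeta tau).
Implicit Types (u v w : int * int) (z x c d : C).

Lemma half_notin_Lambda v : (forall w, w + w <> v) -> ~ Lambda (latt v / 2).
Proof.
move=> vP [w _ wE]; apply: (vP w); apply: (latt_inj htau).
by rewrite lattD wE -splitr.
Qed.

(** The increment of [wzeta] along [latt v], taken at the base point [1 / 2];
by [wzeta_shift] any other point off the lattice gives the same value. *)
Definition quasi v : C :=
  wzeta (latt (1, 0) / 2 + latt v) - wzeta (latt (1, 0) / 2).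

Lemma wzetaD_latt z v : ~ Lambda z -> wzeta (z + latt v) = wzeta z + quasi v.
Proof.
move=> zL; have hL : ~ Lambda (latt (1, 0) / 2).
  by apply: half_notin_Lambda => -[m n] [/double_int_neq1].
by rewrite /quasi -(wzeta_shift htau v zL hL) [RHS]addrC subrK.
Qed.

Lemma quasiD v w : quasi (v + w) = quasi v + quasi w.
Proof.
have hL : ~ Lambda (latt (1, 0) / 2).
  by apply: half_notin_Lambda => -[m n] [/double_int_neq1].
have hvL : ~ Lambda (latt (1, 0) / 2 + latt v) by move=> /LambdaDr.
apply: (@addrI _ (wzeta (latt (1, 0) / 2))); rewrite -(wzetaD_latt _ hL).
by rewrite lattD addrA (wzetaD_latt _ hvL) (wzetaD_latt _ hL) -addrA.
Qed.

Lemma quasi0 : quasi 0 = 0.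
Proof. by rewrite /quasi latt0 addr0 subrr. Qed.

Lemma quasiN v : quasi (- v) = - quasi v.
Proof. by apply/eqP; rewrite -addr_eq0 -quasiD addNr quasi0. Qed.

Lemma zeta_shift_has_sum a b v : ~ Lambda a -> b = a + latt v ->
  has_sum (fun w => (b - latt w)^-1 - (a - latt w)^-1 + (b - a) / latt w ^+ 2)
    (quasi v).
Proof.
move=> aL bE; have bL : ~ Lambda b by rewrite bE => /LambdaDr.
have := has_sumB (wzeta_has_sum htau bL) (wzeta_has_sum htau aL).
rewrite {2}bE wzetaD_latt// addrAC subrr add0r; apply: eq_has_sum => w.
by rewrite /zeta_term; ring.
Qed.

Section HalfPeriod.
Variables (c : C) (v : int * int).
Hypotheses (cL : ~ Lambda c) (cv : c + c = latt v).

Definition zeta_diff2 z : C := wzeta z - (wzeta (z - c) + wzeta (z + c)) / 2.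

Let cN0 : c != 0.
Proof. by apply/eqP => c0; apply: cL; exists 0 => //; rewrite latt0. Qed.

Let addc_notin z : ~ Lambda (z - c) -> ~ Lambda (z + c).
Proof.
by move=> zcL; have -> : z + c = z - c + latt v; [rewrite -cv; ring|
  move=> /LambdaDr].
Qed.

Lemma zeta_diff2_has_sum z : ~ Lambda z -> ~ Lambda (z - c) ->
  has_sum (fun w => diff2_inv c (z - latt w)) (zeta_diff2 z) /\
  decay 3 (fun w => diff2_inv c (z - latt w)).
Proof.
move=> zL zcL; have zcL' := addc_notin zcL.
have E w : zeta_term z (latt w) + (- 2^-1) *
    (zeta_term (z - c) (latt w) + zeta_term (z + c) (latt w)) =
    diff2_inv c (z - latt w).
  rewrite /diff2_inv /zeta_term !(addrAC z (- latt w)).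
  set p := (z - latt w)^-1; set m := (z - c - latt w)^-1.
  set n := (z + c - latt w)^-1; set i := (latt w)^-1; set y := (latt w ^- 2).
  by field.
split; last first.
  apply: eq_decay E _; apply: decayD; first exact: decay_zeta.
  by apply: decayZ; apply: decayD; apply: decay_zeta.
apply: eq_has_sum E _.
have -> : zeta_diff2 z = wzeta z + (- 2^-1) * (wzeta (z - c) + wzeta (z + c)).
  by rewrite /zeta_diff2; ring.
apply: has_sumD; first exact: wzeta_has_sum.
by apply: has_sumZ; apply: has_sumD; apply: wzeta_has_sum.
Qed.

(** The contribution of the double poles to the diagonal sum at [u]: for [u =
0] all three poles of the two factors agree, while for [u = v] and [u = - v] a
single pole of one factor meets a single pole of the other. *)
Let pole_part u z : C :=
  (if u == 0 then wp z + 4^-1 * wp (z - c) + 4^-1 * wp (z + c) else 0)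
  + (if u == v then 4^-1 * wp (z - c) else 0)
  + (if u == - v then 4^-1 * wp (z + c) else 0).

(** The dependence on [z] sits in the double poles alone: the simple poles
contribute increments of [wzeta] along lattice vectors. *)
Lemma diagonal_has_sum u : exists k, forall z, ~ Lambda z -> ~ Lambda (z - c) ->
  has_sum (fun w => diff2_inv c (z - latt (w + u)) * diff2_inv c (z - latt w))
    (k + pole_part u z).
Proof.
set U := latt u; exists (diff2_inv c U * quasi (- u)
  - diff2_inv c (U + c) / 2 * quasi (- u - v)
  - diff2_inv c (U - c) / 2 * quasi (- u + v)) => z zL zcL.
have zcL' := addc_notin zcL.
have h1 : has_sum _ _ := zeta_shift_has_sum zL (erefl (z + latt (- u))).
have h2 : has_sum _ _ :=
  zeta_shift_has_sum zcL' (erefl (z + c + latt (- u - v))).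
have h3 : has_sum _ _ :=
  zeta_shift_has_sum zcL (erefl (z - c + latt (- u + v))).
have p0 := wp_has_sum htau zL; have pm := wp_has_sum htau zcL.
have pp := wp_has_sum htau zcL'.
have d0 : has_sum _ (if u == 0 then _ else 0) :=
  has_sum_if (u == 0)
    (has_sumD (has_sumD p0 (has_sumZ 4^-1 pm)) (has_sumZ 4^-1 pp)).
have dv : has_sum _ (if u == v then _ else 0) :=
  has_sum_if (u == v) (has_sumZ 4^-1 pm).
have dnv : has_sum _ (if u == - v then _ else 0) :=
  has_sum_if (u == - v) (has_sumZ 4^-1 pp).
have {h1 h2 h3} h := has_sumB (has_sumB (has_sumZ (diff2_inv c U) h1)
  (has_sumZ (diff2_inv c (U + c) / 2) h2))
  (has_sumZ (diff2_inv c (U - c) / 2) h3).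
have {d0 dv dnv} d := has_sumD (has_sumD d0 dv) dnv.
apply: eq_has_sum (has_sumD h d) => w /=.
rewrite [RHS]mulrC lattD !lattN !lattD !lattN -cv -/U.
set x := z - latt w; set y := latt w ^- 2.
have -> : z - (latt w + U) = x - U by rewrite /x; ring.
have -> : z + - U - latt w = x - U by rewrite /x; ring.
have -> : z + c + (- U - (c + c)) - latt w = x - U - c by rewrite /x; ring.
have -> : z - c + (- U + (c + c)) - latt w = x - U + c by rewrite /x; ring.
have U0 : (U == 0) = (u == 0) by rewrite -(latt0 tau) (inj_eq (latt_inj htau)).
have Uv : (U == c + c) = (u == v) by rewrite cv (inj_eq (latt_inj htau)).
have Unv : (U == - (c + c)) = (u == - v).
  by rewrite cv -lattN (inj_eq (latt_inj htau)).
have nz a p : ~ Lambda a -> forall b, b = a - latt p -> b != 0.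
  by move=> aL _ ->; exact: subr_latt_neq0.
have xU : x - U = z - latt (w + u) by rewrite lattD /x /U; ring.
rewrite (@diff2_invM _ c x U y cN0); last first.
- by apply: (nz c (- u) cL); rewrite lattN opprK addrC.
- by rewrite -oppr_eq0; apply: (nz c u cL); rewrite opprB.
- by apply: (nz (z + c) (w + u) zcL'); rewrite xU addrAC.
- by apply: (nz (z - c) (w + u) zcL); rewrite xU addrAC.
- exact: (nz z (w + u) zL).
- by apply: (nz (z + c) w zcL'); rewrite /x addrAC.
- by apply: (nz (z - c) w zcL); rewrite /x addrAC.
- exact: (nz z w zL).
rewrite U0 Uv Unv /wp_term -/y.
have -> : z - c - latt w = x - c by rewrite /x; ring.
have -> : z + c - latt w = x + c by rewrite /x; ring.
rewrite -/x.
move: (diff2_inv c U) (diff2_inv c (U + c)) (diff2_inv c (U - c)) => k1 k2 k3.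
by clearbody x y; do 3 (case: ifP => _); ring.
Qed.

(** After reindexing by [(u, w) -> (w + u, w)], the square is the sum over [u]
of the diagonal sums; subtracting the double poles leaves a family [k] that
does not involve the point. *)
Lemma zeta_diff2_sqr z z' : ~ Lambda z -> ~ Lambda (z - c) ->
  ~ Lambda z' -> ~ Lambda (z' - c) ->
  zeta_diff2 z ^+ 2 - wp z - wp (z - c) =
  zeta_diff2 z' ^+ 2 - wp z' - wp (z' - c).
Proof.
have add_bij :
    bijective (fun p : (int * int) * (int * int) => (p.2 + p.1, p.2)).
  exists (fun p : (int * int) * (int * int) => (p.1 - p.2, p.2)) => -[a b] /=.
    by rewrite addrAC subrr add0r.
  by rewrite addrC subrK.
have [k kP] := choice diagonal_has_sum.
have pole_sum a : ~ Lambda a -> ~ Lambda (a - c) ->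
    has_sum (fun u => pole_part u a) (wp a + wp (a - c)).
  move=> aL acL.
  have wpE : wp (a + c) = wp (a - c).
    by rewrite -(wpD_latt htau v acL) -cv; congr (wp _); ring.
  have -> : wp a + wp (a - c) = (wp a + 4^-1 * wp (a - c) + 4^-1 * wp (a + c))
      + 4^-1 * wp (a - c) + 4^-1 * wp (a + c) by rewrite wpE; field.
  by apply: has_sumD; [apply: has_sumD|]; exact: has_sum_pred1.
have sqr_sum a : ~ Lambda a -> ~ Lambda (a - c) ->
    has_sum (fun u => k u + pole_part u a) (zeta_diff2 a * zeta_diff2 a).
  move=> aL acL; have [ha da] := zeta_diff2_has_sum aL acL.
  have H := has_sum_reindex add_bij (has_sum_sqr da ha).
  by apply: (has_sum_fubini H) => u; apply: eq_has_sum (kP u a aL acL).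
have k_sum a : ~ Lambda a -> ~ Lambda (a - c) ->
    has_sum k (zeta_diff2 a ^+ 2 - wp a - wp (a - c)).
  move=> aL acL; rewrite expr2 -addrA -opprD.
  apply: eq_has_sum (has_sumB (sqr_sum a aL acL) (pole_sum a aL acL)) => u.
  by rewrite addrK.
by move=> zL zcL zL' zcL'; apply: has_sum_unique (k_sum _ _ _) (k_sum _ _ _).
Qed.

End HalfPeriod.
End Squares.

(** * Values at the half periods *)

Definition parity_merge (p : bool * int) : int := p.2 + p.2 + (p.1 : nat)%:Z.

Lemma parity_merge_bij : bijective parity_merge.
Proof.
exists (fun n => ((n %% 2)%Z == 1, (n %/ 2)%Z)) => [[b m]|n] /=.
  by rewrite /parity_merge /=; case: b => /=; congr pair; lia.
by rewrite /parity_merge /=; case: eqP => /=; lia.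
Qed.

Definition residue2 (b : bool * bool) : int * int :=
  ((b.1 : nat)%:Z, (b.2 : nat)%:Z).

Lemma residue2_merge_bij :
  bijective (fun p : (bool * bool) * (int * int) => p.2 + p.2 + residue2 p.1).
Proof.
have [g gK Kg] := parity_merge_bij.
exists (fun n : int * int =>
  (((g n.1).1, (g n.2).1), ((g n.1).2, (g n.2).2))) => [[[a b] [m n]]|[m n]] /=.
  have := gK (a, m); have := gK (b, n); rewrite /parity_merge /= => h1 h2.
  by rewrite h1 h2.
have := Kg m; have := Kg n; rewrite /parity_merge.
by case: (g m) (g n) => [a m'] [b n'] /= <- <-.
Qed.

Section HalfPeriods.
Variables (R : realType) (tau : Cplx R).
Hypothesis htau : 0 < complex.Im tau.
Local Notation C := (Cplx R).
Local Notation latt := (latt tau).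
Local Notation Lambda := (Lambda tau).
Local Notation wp := (wp tau).
Local Notation wzeta := (wzeta tau).
Local Notation quasi := (quasi tau).
Implicit Types (u v w : int * int) (z x c d : C).

(** The second difference is odd and has the period [d + d], so that its values
at [d] and at [- d] are both equal and opposite. *)
Lemma zeta_diff2_half c v d w : c + c = latt v -> d + d = latt w ->
  ~ Lambda d -> ~ Lambda (d - c) -> zeta_diff2 tau c d = 0.
Proof.
move=> cv dw dL dcL.
have dcL' : ~ Lambda (d + c).
  by have -> : d + c = d - c + latt v; [rewrite -cv; ring | move=> /LambdaDr].
have oppL (a : C) : ~ Lambda a -> ~ Lambda (- a).
  by move=> aL /LambdaN; rewrite opprK.
have e0 : wzeta d = wzeta (- d) + quasi w.
  by rewrite -(wzetaD_latt htau _ (oppL _ dL)) -dw addrA addNr add0r.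
have e1 : wzeta (d - c) = wzeta (- (d + c)) + quasi w.
  rewrite -(wzetaD_latt htau _ (oppL _ dcL')) -dw; congr (wzeta _); ring.
have e2 : wzeta (d + c) = wzeta (- (d - c)) + quasi w.
  rewrite -(wzetaD_latt htau _ (oppL _ dcL)) -dw; congr (wzeta _); ring.
move: e0 e1 e2; rewrite !wzetaN// => e0 e1 e2.
have q2 : quasi w = wzeta d + wzeta d by rewrite {2}e0; ring.
by rewrite /zeta_diff2 e1 q2; field.
Qed.

(** Centering the compensating terms at [latt w + c] instead of [latt w]
changes the sum by an affine function of [z], with slope [wp (- c)]. *)
Lemma half_shift_has_sum c z : ~ Lambda c -> ~ Lambda (z - c) ->
  has_sum (fun w => zeta_term z (latt w + c))
    (wzeta (z - c) - wzeta (- c) + z * wp (- c)).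
Proof.
move=> cL zcL; have cL' : ~ Lambda (- c) by move=> /LambdaN; rewrite opprK.
apply: eq_has_sum (has_sumD (has_sumB (wzeta_has_sum htau zcL)
  (wzeta_has_sum htau cL')) (has_sumZ z (wp_has_sum htau cL'))) => w.
rewrite /zeta_term /wp_term -[- c - latt w]opprD sqrrN invrN.
have -> : z - (latt w + c) = z - c - latt w by ring.
rewrite (addrC c); ring.
Qed.

Definition half_period (b : bool * bool) : C := latt (residue2 b) / 2.

Lemma half_period0 : half_period (false, false) = 0.
Proof. by rewrite /half_period (_ : residue2 _ = 0)// latt0 mul0r. Qed.

Lemma half_period_double b : half_period b + half_period b = latt (residue2 b).
Proof. by rewrite /half_period -splitr. Qed.

Lemma half_period_notin b : b != (false, false) -> ~ Lambda (half_period b).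
Proof.
move=> b0; apply: (half_notin_Lambda htau) => -[m n] [].
by move: b0; case: b => [[] []]//= _ => [/double_int_neq1|/double_int_neq1|
  _ /double_int_neq1].
Qed.

Lemma subr_half_period_notin z b :
  ~ Lambda (z + z) -> ~ Lambda (z - half_period b).
Proof.
move=> zzL [w _ wE]; apply: zzL; exists (w + w + residue2 b) => //.
by rewrite !lattD -half_period_double wE; ring.
Qed.

Lemma zeta_term_double z x : 2 * zeta_term (z + z) (x + x) = zeta_term z x.
Proof.
rewrite /zeta_term; have -> : z + z - (x + x) = 2 * (z - x) by ring.
have -> : x + x = 2 * x by ring.
rewrite exprMn !invfM.
set a := (z - x)^-1; set b := x^-1; set y := x ^- 2; by field.
Qed.

(** The series of [2 wzeta (2 z)] is that of [wzeta z] extended to the lattice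
of half periods, which is sorted here into its four cosets. *)
Lemma zeta_duplication z : ~ Lambda (z + z) ->
  2 * wzeta (z + z) = wzeta z
    + (wzeta (z - half_period (true, false))
       - wzeta (- half_period (true, false))
       + z * wp (- half_period (true, false)))
    + (wzeta (z - half_period (false, true))
       - wzeta (- half_period (false, true))
       + z * wp (- half_period (false, true)))
    + (wzeta (z - half_period (true, true)) - wzeta (- half_period (true, true))
       + z * wp (- half_period (true, true))).
Proof.
move=> zzL.
have zL b : ~ Lambda (z - half_period b) by exact: subr_half_period_notin.
pose g (b : bool * bool) := if b == (false, false) then wzeta z else
  wzeta (z - half_period b) - wzeta (- half_period b)
  + z * wp (- half_period b).
have gP b : has_sum (fun w => zeta_term z (latt w + half_period b)) (g b).
  rewrite /g; case: eqP => [->|/eqP b0]; last first.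
    by apply: half_shift_has_sum => //; exact: half_period_notin.
  rewrite half_period0; have := zL (false, false).
  rewrite half_period0 subr0 => /(wzeta_has_sum htau).
  by apply: eq_has_sum => w; rewrite addr0.
have H := has_sum_reindex residue2_merge_bij
  (has_sumZ 2 (wzeta_has_sum htau zzL)).
have {}H : has_sum (fun p : (bool * bool) * (int * int) =>
    zeta_term z (latt p.2 + half_period p.1)) (2 * wzeta (z + z)).
  apply: eq_has_sum H => -[b w] /=.
  by rewrite -[RHS]zeta_term_double !lattD -half_period_double addrACA.
have := has_sum_unique (has_sum_fubini H gP) (has_sum_fin g).
rewrite -(pair_bigA _ (fun a b => g (a, b)))/= !big_bool/= => ->.
rewrite -[RHS]/(g (false, false) + g (true, false) + g (false, true)
  + g (true, true)).
move: (g (true, true)) (g (true, false)) (g (false, true)) (g (false, false)).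
by move=> *; ring.
Qed.

(** Under [z -> z + 1] the left side of [zeta_duplication] grows by twice the
increment of [wzeta] along [2], that is four times the increment along [1], and
so do the four zeta functions on the right; the linear term must be zero. *)
Lemma half_wp_sum :
  wp (half_period (true, false)) + wp (half_period (false, true))
  + wp (half_period (true, true)) = 0.
Proof.
pose z := half_period (true, false) / 2.
have zz : z + z = half_period (true, false) by rewrite -splitr.
have zzL : ~ Lambda (z + z) by rewrite zz; exact: half_period_notin.
pose v : int * int := (1, 0).
have lv : latt v = 1 by rewrite /Defs.latt /= mul0r addr0.
have z2 : z + 1 + (z + 1) = z + z + latt (v + v) by rewrite lattD lv; ring.
have zzL' : ~ Lambda (z + 1 + (z + 1)) by rewrite z2 => /LambdaDr.
have zL b : ~ Lambda (z - half_period b) by exact: subr_half_period_notin.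
have z0L : ~ Lambda z.
  by have := zL (false, false); rewrite half_period0 subr0.
have wz b : wzeta (z + 1 - half_period b) = wzeta (z - half_period b) + quasi v.
  by rewrite -(wzetaD_latt htau _ (zL b)) lv addrAC.
have wz0 : wzeta (z + 1) = wzeta z + quasi v.
  by rewrite -(wzetaD_latt htau _ z0L) lv.
have := zeta_duplication zzL'.
rewrite [in LHS]z2 (wzetaD_latt htau _ zzL) wz0 !wz (quasiD htau).
rewrite mulrDr (zeta_duplication zzL) !(wpN htau)//;
  try exact: half_period_notin.
move=> /eqP; rewrite -subr_eq0 => /eqP H.
rewrite -[RHS]oppr0 -H.
move: (wp (half_period (true, false))) (wp (half_period (false, true))).
move: (wp (half_period (true, true))) (quasi v) (wzeta z).
move: (wzeta (z - half_period (true, false))).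
move: (wzeta (z - half_period (false, true))).
move: (wzeta (z - half_period (true, true))).
move: (wzeta (- half_period (true, false))).
move: (wzeta (- half_period (false, true))).
by move: (wzeta (- half_period (true, true))) => *; ring.
Qed.

End HalfPeriods.

(** * The derivative of zeta *)

Local Open Scope classical_set_scope.

Section Derivative.
Variables (R : realType) (tau : Cplx R).
Hypothesis htau : 0 < complex.Im tau.
Local Notation C := (Cplx R).
Local Notation latt := (latt tau).
Local Notation Lambda := (Lambda tau).
Local Notation wp := (wp tau).
Local Notation wzeta := (wzeta tau).
Implicit Types (u v w : int * int) (z x c d : C).

Lemma near_off_lattice z : ~ Lambda z -> exists2 k : C, 0 < k &
  forall h, `|h| < k -> forall w, k * (weight w)%:R <= `|z + h - latt w|.
Proof.
move=> zL; have [k k0 kP] := off_lattice htau zL.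
exists (k / 2) => [|h hk w]; first by rewrite divr_gt0.
have -> : z + h - latt w = z - latt w - - h by ring.
rewrite (le_trans _ (lerB_dist _ _))// normrN.
have hk' : `|h| <= k / 2 * (weight w)%:R.
  by rewrite (le_trans (ltW hk))// ler_peMr ?ler1n// ltW// divr_gt0.
rewrite lerBrDr (le_trans _ (kP w))// (le_trans (lerD (lexx _) hk'))//.
by rewrite -mulrDl -splitr.
Qed.

Lemma near_notin_Lambda z p : ~ Lambda (z - p) ->
  \forall x \near z, ~ Lambda (x - p).
Proof.
move=> zL; have [k k0 kP] := near_off_lattice zL.
apply/nbhs_ballP; exists k => // x /= zx [w _ wx].
have kw : 0 < k * (weight w)%:R by rewrite mulr_gt0// ltr0n.
have xz : `|x - z| < k by rewrite distrC.
have := lt_le_trans kw (kP _ xz w).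
have -> : z - p + (x - z) - latt w = 0 by rewrite wx; ring.
by rewrite normr0 ltxx.
Qed.

(** Termwise, the difference quotient of the zeta term plus the wp term is [h /
((z + h - w) (z - w) ^ 2)], whose sum is of size [h]. *)
Lemma wzeta_diff_quotient z : ~ Lambda z -> exists2 k : C, 0 < k &
  exists2 M : C, 0 < M & forall h, h != 0 -> `|h| < k ->
  `|h^-1 * (wzeta (h + z) - wzeta z) + wp z| <= `|h| * M.
Proof.
move=> zL; have [k k0 kP] := near_off_lattice zL; exists k => //.
exists (k ^- 3 * 16) => [|h h0 hk].
  by rewrite mulr_gt0// invr_gt0 exprn_gt0.
have zhL : ~ Lambda (h + z).
  move=> [w _ wE]; have kw : 0 < k * (weight w)%:R by rewrite mulr_gt0// ltr0n.
  have := lt_le_trans kw (kP h hk w).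
  have -> : z + h - latt w = 0 by rewrite wE; ring.
  by rewrite normr0 ltxx.
have H := has_sumD (has_sumZ h^-1 (has_sumB (wzeta_has_sum htau zhL)
  (wzeta_has_sum htau zL))) (wp_has_sum htau zL).
apply: (has_sum_norm_le H) => A.
apply: (@le_trans _ _ (\sum_(w <- A) `|h| * (k ^- 3 * (weight w)%:R ^- 3))).
  rewrite (le_trans (ler_norm_sum _ _ _))//; apply: ler_sum => w _.
  have a1 := kP h hk w; have := kP 0; rewrite normr0 addr0 => /(_ k0 w) a2.
  have kw : 0 < k * (weight w)%:R by rewrite mulr_gt0// ltr0n.
  have n1 : 0 < `|z + h - latt w| by exact: lt_le_trans a1.
  have n2 : 0 < `|z - latt w| by exact: lt_le_trans a2.
  have -> : h^-1 * (zeta_term (h + z) (latt w) - zeta_term z (latt w))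
      + wp_term z (latt w) =
      h * ((z + h - latt w)^-1 * (z - latt w)^-1 * (z - latt w)^-1).
    rewrite /zeta_term /wp_term (addrC h).
    move: n1 n2; rewrite !normr_gt0 => n1 n2.
    set b := (latt w)^-1; set y := (latt w ^- 2).
    by field; rewrite h0 n1 n2.
  rewrite normrM ler_wpM2l// 2!normrM !normfV.
  have -> : k ^- 3 * (weight w)%:R ^- 3 = (k * (weight w)%:R)^-1
      * (k * (weight w)%:R)^-1 * (k * (weight w)%:R)^-1.
    by rewrite -invfM -exprMn -exprVn exprS expr2 mulrA.
  by rewrite !ler_pM ?mulr_ge0 ?invr_ge0// lef_pV2// posrE.
rewrite -mulr_sumr ler_wpM2l// -mulr_sumr ler_wpM2l ?sum_weight_le//.
by rewrite invr_ge0 exprn_ge0// ltW.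
Qed.

Lemma is_derive_wzeta z : ~ Lambda z -> is_derive z 1 wzeta (- wp z).
Proof.
move=> zL; have [k k0 [M M0 kP]] := wzeta_diff_quotient zL.
have H : h^-1 *: (wzeta (h *: 1 + z) - wzeta z) @[h --> 0^'] --> - wp z.
  apply/cvgrPdist_lt => e e0; near=> h.
  rewrite distrC opprK scaler1.
  apply: le_lt_trans (kP h _ _) _.
  - by near: h; exact: nbhs_dnbhs_neq.
  - near: h; apply: dnbhs0_lt. done.
  - rewrite -ltr_pdivlMr//; near: h; apply: dnbhs0_lt; exact: divr_gt0.
apply: DeriveDef; first by apply/cvg_ex; exists (- wp z).
exact: cvg_lim H.
Unshelve. all: by end_near. Qed.

End Derivative.

(** * The differential relations and the spectral polynomial *)

Section SpectralIdentity.
Variable C : numFieldType.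
Implicit Types (s f g : C -> C) (z T P : C).

(** Here [s] plays [sigma_l], while [f] and [g] play the other two. The second
derivative comes from differentiating the product [f g], so only the relation
for [s] has to hold in a neighbourhood of [z]. *)
Lemma spectral_identity s f g z T P (e1 e2 e3 : C) :
  (\forall x \near z, is_derive (x : C) (1 : C) s (- (f x * g x))) ->
  is_derive z 1 f (- (s z * g z)) -> is_derive z 1 g (- (s z * f z)) ->
  s z ^+ 2 = P - 4 * e1 -> f z ^+ 2 = P - 4 * e2 -> g z ^+ 2 = P - 4 * e3 ->
  e1 + e2 + e3 = 0 ->
  let F x := 2 * T - s x in
  derive1 F z ^+ 2 - 2 * derive1n 2 F z * F z
    + 4 * (3 / 4 * P + T * s z + T ^+ 2) * F z ^+ 2
  = 16 * (T ^+ 2 + e1 - e2) * (T ^+ 2 + e1 - e3).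
Proof.
move=> ds df dg s2 f2 g2 e0 F.
have dF (x : C) :
    is_derive x (1 : C) s (- (f x * g x)) -> derive1 F x = f x * g x.
  move=> dsx; rewrite derive1E.
  have : is_derive x 1 F (0 - - (f x * g x)).
    exact: is_deriveB.
  by move=> [_ ->]; rewrite sub0r opprK.
have F1 : derive1 F z = f z * g z by apply: dF; exact: nbhs_singleton ds.
have F2 : derive1n 2 F z = - s z * (f z ^+ 2 + g z ^+ 2).
  rewrite derive1nS derive1n1 derive1E.
  rewrite (@near_eq_derive _ _ _ _ (fun x => f x * g x)); last first.
    by near=> x; apply: dF; near: x.
  have := is_deriveM df dg => -[_ ->].
  by rewrite /GRing.scale /=; ring.
have e3E : e3 = - e1 - e2 by apply/eqP; rewrite -subr_eq0 -e0; apply/eqP; ring.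
have PE : P = s z ^+ 2 + 4 * e1 by rewrite s2; ring.
rewrite F1 F2 exprMn f2 g2 /F PE e3E.
by field.
Unshelve. all: by end_near. Qed.

End SpectralIdentity.

(** Adding and subtracting the hypotheses in pairs gives the pairwise sums of
squares and the pairwise products. *)
Lemma polarization (K : numFieldType) (A B G w0 w1 w2 w3 e1 e2 e3 : K) :
  (B + G) ^+ 2 = 4 * (w0 + w1 - e2 - e3) ->
  (B - G) ^+ 2 = 4 * (w2 + w3 - e2 - e3) ->
  (A + G) ^+ 2 = 4 * (w0 + w2 - e1 - e3) ->
  (A - G) ^+ 2 = 4 * (w1 + w3 - e1 - e3) ->
  (A + B) ^+ 2 = 4 * (w0 + w3 - e1 - e2) ->
  (A - B) ^+ 2 = 4 * (w1 + w2 - e1 - e2) ->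
  [/\ A ^+ 2 = w0 + w1 + w2 + w3 - 4 * e1, B ^+ 2 = w0 + w1 + w2 + w3 - 4 * e2
    & G ^+ 2 = w0 + w1 + w2 + w3 - 4 * e3] /\
  [/\ B * G = w0 + w1 - w2 - w3, A * G = w0 - w1 + w2 - w3
    & A * B = w0 - w1 - w2 + w3].
Proof.
move=> h1 h2 h3 h4 h5 h6; have two (x y : K) : 4 * x = 4 * y -> x = y.
  by apply: mulfI; rewrite pnatr_eq0.
split; split; apply: two.
- transitivity ((A + G) ^+ 2 + (A - G) ^+ 2 + ((A + B) ^+ 2 + (A - B) ^+ 2)
    - ((B + G) ^+ 2 + (B - G) ^+ 2)); first by ring.
  by rewrite h1 h2 h3 h4 h5 h6; ring.
- transitivity ((B + G) ^+ 2 + (B - G) ^+ 2 + ((A + B) ^+ 2 + (A - B) ^+ 2)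
    - ((A + G) ^+ 2 + (A - G) ^+ 2)); first by ring.
  by rewrite h1 h2 h3 h4 h5 h6; ring.
- transitivity ((A + G) ^+ 2 + (A - G) ^+ 2 + ((B + G) ^+ 2 + (B - G) ^+ 2)
    - ((A + B) ^+ 2 + (A - B) ^+ 2)); first by ring.
  by rewrite h1 h2 h3 h4 h5 h6; ring.
- by transitivity ((B + G) ^+ 2 - (B - G) ^+ 2); [ring|rewrite h1 h2; ring].
- by transitivity ((A + G) ^+ 2 - (A - G) ^+ 2); [ring|rewrite h3 h4; ring].
- by transitivity ((A + B) ^+ 2 - (A - B) ^+ 2); [ring|rewrite h5 h6; ring].
Qed.

Section Sigma.
Variables (R : realType) (tau : Cplx R).
Hypothesis htau : 0 < complex.Im tau.
Local Notation C := (Cplx R).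
Local Notation latt := (latt tau).
Local Notation Lambda := (Lambda tau).
Local Notation wp := (wp tau).
Local Notation wzeta := (wzeta tau).
Local Notation quasi := (quasi tau).
Implicit Types (u v w : int * int) (z x c d : C).

Variables (p1 p2 p3 : C) (a b : int * int).
Hypotheses (p1L : ~ Lambda p1) (p2L : ~ Lambda p2) (p3L : ~ Lambda p3).
Hypotheses (p11 : p1 + p1 = latt a) (p22 : p2 + p2 = latt b).
Hypothesis (p12 : p1 + p2 = p3).

Let p33 : p3 + p3 = latt (a + b).
Proof. by rewrite lattD -p11 -p22 -p12 addrACA. Qed.

(** The alternating zeta sums of the three cases, normalized to be odd. *)
Definition sigma1 z := wzeta z + wzeta (z - p1) - wzeta (z - p2)
  - wzeta (z - p3) - quasi b.
Definition sigma2 z := wzeta z - wzeta (z - p1) + wzeta (z - p2)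
  - wzeta (z - p3) - quasi a.
Definition sigma3 z := wzeta z - wzeta (z - p1) - wzeta (z - p2)
  + wzeta (z - p3).

Definition off_half z :=
  [/\ ~ Lambda z, ~ Lambda (z - p1), ~ Lambda (z - p2) & ~ Lambda (z - p3)].

(** The constant in [zeta_diff2_sqr] is found at the point [d]. *)
Lemma zeta_diff2_sqrE c v d w z : c + c = latt v -> d + d = latt w ->
  ~ Lambda c -> ~ Lambda d -> ~ Lambda (d + c) ->
  ~ Lambda z -> ~ Lambda (z - c) ->
  zeta_diff2 tau c z ^+ 2 = wp z + wp (z - c) - wp d - wp (d + c).
Proof.
move=> cv dw cL dL dcL zL zcL.
have dcE : d + c = d - c + latt v by rewrite -cv; ring.
have dcL' : ~ Lambda (d - c) by move: dcL; rewrite dcE => + /LambdaDr.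
have := zeta_diff2_sqr htau cL cv zL zcL dL dcL'.
rewrite (zeta_diff2_half htau cv dw dL dcL') expr0n sub0r dcE.
rewrite (wpD_latt htau v dcL') => /eqP.
rewrite -addrA -opprD subr_eq => /eqP ->.
by ring.
Qed.

(** Two of the sigmas agree in the sign of exactly two zeta functions. Their
sum keeps the pair containing [wzeta z], their difference ([sigma_diffs]) the
other pair, and each pair is a second difference up to quasi-periods. *)
Lemma sigma_sums z : off_half z ->
  [/\ sigma2 z + sigma3 z = 2 * zeta_diff2 tau p1 z,
      sigma1 z + sigma3 z = 2 * zeta_diff2 tau p2 z &
      sigma1 z + sigma2 z = 2 * zeta_diff2 tau p3 z].
Proof.
move=> [zL z1 z2 z3]; rewrite /zeta_diff2.
have -> : z + p1 = z - p1 + latt a by rewrite -p11; ring.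
have -> : z + p2 = z - p2 + latt b by rewrite -p22; ring.
have -> : z + p3 = z - p3 + latt (a + b) by rewrite -p33; ring.
rewrite !(wzetaD_latt htau)// (quasiD htau) /sigma1 /sigma2 /sigma3.
set y0 := wzeta z; set y1 := wzeta (z - p1).
set y2 := wzeta (z - p2); set y3 := wzeta (z - p3).
set qa := quasi a; set qb := quasi b; clearbody y0 y1 y2 y3 qa qb.
by split; field.
Qed.

Lemma sigma_diffs z : off_half z ->
  [/\ sigma2 z - sigma3 z = 2 * zeta_diff2 tau p1 (z - p2),
      sigma1 z - sigma3 z = 2 * zeta_diff2 tau p2 (z - p1) &
      sigma1 z - sigma2 z = 2 * zeta_diff2 tau p3 (z - p1)].
Proof.
move=> [zL z1 z2 z3]; rewrite /zeta_diff2.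
have -> : z - p2 - p1 = z - p3 by rewrite -p12; ring.
have -> : z - p2 + p1 = z - p3 + latt a by rewrite -p11 -p12; ring.
have -> : z - p1 - p2 = z - p3 by rewrite -p12; ring.
have -> : z - p1 + p2 = z - p3 + latt b by rewrite -p22 -p12; ring.
have -> : z - p1 + p3 = z - p2 + latt b by rewrite -p22 -p12; ring.
have -> : z - p1 - p3 = z - p2 + latt (- a) by rewrite lattN -p11 -p12; ring.
rewrite !(wzetaD_latt htau)//.
rewrite (quasiN htau) /sigma1 /sigma2 /sigma3.
set y0 := wzeta z; set y1 := wzeta (z - p1).
set y2 := wzeta (z - p2); set y3 := wzeta (z - p3).
set qa := quasi a; set qb := quasi b; clearbody y0 y1 y2 y3 qa qb.
by split; field.
Qed.

Lemma sigma_sqr_sums z : off_half z ->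
  [/\ (sigma2 z + sigma3 z) ^+ 2 = 4 * (wp z + wp (z - p1) - wp p2 - wp p3),
      (sigma2 z - sigma3 z) ^+ 2 =
        4 * (wp (z - p2) + wp (z - p3) - wp p2 - wp p3),
      (sigma1 z + sigma3 z) ^+ 2 = 4 * (wp z + wp (z - p2) - wp p1 - wp p3),
      (sigma1 z - sigma3 z) ^+ 2 =
        4 * (wp (z - p1) + wp (z - p3) - wp p1 - wp p3) &
      (sigma1 z + sigma2 z) ^+ 2 = 4 * (wp z + wp (z - p3) - wp p1 - wp p2) /\
      (sigma1 z - sigma2 z) ^+ 2 =
        4 * (wp (z - p1) + wp (z - p2) - wp p1 - wp p2)].
Proof.
move=> zo; have [-> -> ->] := sigma_sums zo; have [-> -> ->] := sigma_diffs zo.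
case: zo => zL z1 z2 z3.
have p21 : p2 + p1 = p3 by rewrite addrC p12.
have p13 : p1 + p3 = p2 + latt a by rewrite -p11 -p12; ring.
have p21L : ~ Lambda (p2 + p1) by rewrite p21.
have p12L : ~ Lambda (p1 + p2) by rewrite p12.
have p13L : ~ Lambda (p1 + p3) by rewrite p13 => /LambdaDr.
have z21 : z - p2 - p1 = z - p3 by rewrite -p12; ring.
have z12 : z - p1 - p2 = z - p3 by rewrite -p12; ring.
have z13 : z - p1 - p3 = z - p2 + latt (- a) by rewrite lattN -p11 -p12; ring.
have z21L : ~ Lambda (z - p2 - p1) by rewrite z21.
have z12L : ~ Lambda (z - p1 - p2) by rewrite z12.
have z13L : ~ Lambda (z - p1 - p3) by rewrite z13 => /LambdaDr.
rewrite !exprMn (zeta_diff2_sqrE p11 p22 p1L p2L p21L zL z1).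
rewrite (zeta_diff2_sqrE p11 p22 p1L p2L p21L z2 z21L).
rewrite (zeta_diff2_sqrE p22 p11 p2L p1L p12L zL z2).
rewrite (zeta_diff2_sqrE p22 p11 p2L p1L p12L z1 z12L).
rewrite (zeta_diff2_sqrE p33 p11 p3L p1L p13L zL z3).
rewrite (zeta_diff2_sqrE p33 p11 p3L p1L p13L z1 z13L).
rewrite p21 p12 p13 z21 z12 z13 !(wpD_latt htau)//.
by do !split; ring.
Qed.

Lemma sigma_sqr_mul z : off_half z ->
  let P := wp z + wp (z - p1) + wp (z - p2) + wp (z - p3) in
  [/\ sigma1 z ^+ 2 = P - 4 * wp p1, sigma2 z ^+ 2 = P - 4 * wp p2 &
      sigma3 z ^+ 2 = P - 4 * wp p3] /\
  [/\ sigma2 z * sigma3 z = wp z + wp (z - p1) - wp (z - p2) - wp (z - p3),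
      sigma1 z * sigma3 z = wp z - wp (z - p1) + wp (z - p2) - wp (z - p3) &
      sigma1 z * sigma2 z = wp z - wp (z - p1) - wp (z - p2) + wp (z - p3)].
Proof. by move=> /sigma_sqr_sums[h1 h2 h3 h4 [h5 h6]]; apply: polarization. Qed.

Lemma near_off_half z : off_half z -> \forall x \near z, off_half x.
Proof.
move=> [zL z1 z2 z3].
have h0 : \forall x \near z, ~ Lambda (x - 0).
  by apply: near_notin_Lambda => //; rewrite subr0.
have h1 := near_notin_Lambda htau z1; have h2 := near_notin_Lambda htau z2.
have h3 := near_notin_Lambda htau z3.
by near=> x; split; [rewrite -(subr0 x)|..]; near: x.
Unshelve. all: by end_near. Qed.

Lemma is_derive_wzeta_shift z (p : C) : ~ Lambda (z - p) ->
  is_derive z (1 : C) (fun x => wzeta (x - p)) (- wp (z - p)).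
Proof.
move=> /(is_derive_wzeta htau)[dz zE].
have E : (fun h : C => h^-1 *: (wzeta (h *: (1 : C) + z - p) - wzeta (z - p)))
  = (fun h : C => h^-1 *: (wzeta (h *: (1 : C) + (z - p)) - wzeta (z - p))).
  by apply/funext => h; rewrite addrA.
by apply: DeriveDef; [rewrite /derivable E | rewrite /derive E].
Qed.

(** The derivative is an alternating sum of wp functions, which [sigma_sqr_mul]
recognizes as a product. *)
Lemma is_derive_sigma z : off_half z ->
  [/\ is_derive z (1 : C) sigma1 (- (sigma2 z * sigma3 z)),
      is_derive z (1 : C) sigma2 (- (sigma1 z * sigma3 z)) &
      is_derive z (1 : C) sigma3 (- (sigma1 z * sigma2 z))].
Proof.
move=> zo; have [_ [-> -> ->]] := sigma_sqr_mul zo; case: zo => zL z1 z2 z3.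
have d0 := is_derive_wzeta htau zL; have d1 := is_derive_wzeta_shift z1.
have d2 := is_derive_wzeta_shift z2; have d3 := is_derive_wzeta_shift z3.
split.
- have H : is_derive z (1 : C) sigma1 _ := is_deriveB (is_deriveB (is_deriveB
    (is_deriveD d0 d1) d2) d3) (is_derive_cst (quasi b) z (1 : C)).
  by apply: (is_derive_eq H); ring.
- have H : is_derive z (1 : C) sigma2 _ := is_deriveB (is_deriveB (is_deriveD
    (is_deriveB d0 d1) d2) d3) (is_derive_cst (quasi a) z (1 : C)).
  by apply: (is_derive_eq H); ring.
- have H : is_derive z (1 : C) sigma3 _ := is_deriveD (is_deriveB
    (is_deriveB d0 d1) d2) d3.
  by apply: (is_derive_eq H); ring.
Qed.

End Sigma.

Variant permutation_123 (l j k : nat) : Prop :=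
  | Perm123 of [/\ l = 1%N, j = 2%N & k = 3%N]
  | Perm132 of [/\ l = 1%N, j = 3%N & k = 2%N]
  | Perm213 of [/\ l = 2%N, j = 1%N & k = 3%N]
  | Perm231 of [/\ l = 2%N, j = 3%N & k = 1%N]
  | Perm312 of [/\ l = 3%N, j = 1%N & k = 2%N]
  | Perm321 of [/\ l = 3%N, j = 2%N & k = 1%N].

Lemma perm_eq_123 (l j k : nat) :
  perm_eq [:: l; j; k] [:: 1%N; 2%N; 3%N] -> permutation_123 l j k.
Proof.
move=> ljk; have mem i : i \in [:: l; j; k] -> i \in [:: 1%N; 2%N; 3%N].
  by rewrite (perm_mem ljk).
have := perm_uniq ljk.
have := mem k; have := mem j; have := mem l; rewrite !inE !eqxx !orbT.
by case/(_ isT)/or3P=> /eqP->; case/(_ isT)/or3P=> /eqP->;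
  case/(_ isT)/or3P=> /eqP-> // _; constructor.
Qed.

Section Main.
Variables (R : realType) (tau : Cplx R).
Hypothesis htau : 0 < complex.Im tau.
Local Notation C := (Cplx R).
Local Notation latt := (latt tau).
Local Notation Lambda := (Lambda tau).
Local Notation wp := (wp tau).
Local Notation wzeta := (wzeta tau).
Local Notation quasi := (quasi tau).
Local Notation half_period := (half_period tau).
Implicit Types (u v w : int * int) (z x c d : C).

Lemma etaE k v : omega tau k = latt v -> eta tau k = quasi v.
Proof.
move=> kv; have L1 : ~ Lambda (half_period (true, false)).
  exact: half_period_notin.
rewrite /eta; set A := [set c | _].
have : A (get A).
  apply: getPex; exists (quasi v) => z zL.
  by rewrite kv wzetaD_latt// addrC addKr.
move=> /(_ _ L1) <-; rewrite kv wzetaD_latt//.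
by rewrite addrC addKr.
Qed.

Lemma omegaE k : omega tau k / 2 =
  [:: 0; half_period (true, false); half_period (false, true);
      half_period (true, true)]`_k.
Proof.
case: k => [|[|[|[|k]]]]; rewrite /omega /half_period /latt /=.
- by rewrite mul0r.
- by rewrite mul0r addr0.
- by rewrite mul1r add0r.
- by rewrite mul1r.
- by rewrite nth_nil mul0r.
Qed.

End Main.

Theorem proposition3p4 (R : realType) (tau : Cplx R) (htau : 0 < complex.Im tau)
  (l j k : nat) (hljk : perm_eq [:: l; j; k] [:: 1%N; 2%N; 3%N]) (T z : Cplx R)
  (hz : regular tau z) :
  spectral_poly tau l T z =
    16 * (T ^+ 2 + e tau l - e tau j) * (T ^+ 2 + e tau l - e tau k).
Proof.
set p1 := half_period tau (true, false).
set p2 := half_period tau (false, true).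
set p3 := half_period tau (true, true).
have p1L : ~ Lambda tau p1 by exact: half_period_notin.
have p2L : ~ Lambda tau p2 by exact: half_period_notin.
have p3L : ~ Lambda tau p3 by exact: half_period_notin.
have p11 : p1 + p1 = latt tau (1, 0) by exact: half_period_double.
have p22 : p2 + p2 = latt tau (0, 1) by exact: half_period_double.
have p12 : p1 + p2 = p3 by rewrite /p1 /p2 /p3 /half_period -mulrDl -lattD.
have zo : off_half tau p1 p2 p3 z.
  have h k' : (k' < 4)%N -> ~ Lambda tau (z - [:: 0; p1; p2; p3]`_k').
    by move=> /hz; rewrite omegaE.
  by split; [have := h 0%N|exact: (h 1%N)|exact: (h 2%N)|exact: (h 3%N)];
    rewrite /= ?subr0//; apply.
have eta0 : eta tau 0 = 0.
  by rewrite (@etaE R tau htau 0%N 0) ?latt0// quasi0.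
have eta1 : eta tau 1 = quasi tau (1, 0).
  by apply: (etaE htau); rewrite /omega /latt /= mul0r addr0.
have eta2 : eta tau 2 = quasi tau (0, 1).
  by apply: (etaE htau); rewrite /omega /latt /= mul1r add0r.
have [[S1 S2 S3] _] := sigma_sqr_mul htau p1L p2L p3L p11 p22 p12 zo.
have near_zo := near_off_half htau zo.
have D := is_derive_sigma htau p1L p2L p3L p11 p22 p12.
have [D1 D2 D3] := D _ zo.
have N1 : \forall x \near z, is_derive (x : Cplx R) (1 : Cplx R)
   (sigma1 tau p1 p2 p3 (0, 1))
   (- (sigma2 tau p1 p2 p3 (1, 0) x * sigma3 tau p1 p2 p3 x)).
  by near=> x; case: (D x) => //; near: x.
have N2 : \forall x \near z, is_derive (x : Cplx R) (1 : Cplx R)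
   (sigma2 tau p1 p2 p3 (1, 0))
   (- (sigma1 tau p1 p2 p3 (0, 1) x * sigma3 tau p1 p2 p3 x)).
  by near=> x; case: (D x) => //; near: x.
have N3 : \forall x \near z, is_derive (x : Cplx R) (1 : Cplx R)
   (sigma3 tau p1 p2 p3)
   (- (sigma1 tau p1 p2 p3 (0, 1) x * sigma2 tau p1 p2 p3 (1, 0) x)).
  by near=> x; case: (D x) => //; near: x.
(* the roles of the three half periods are permuted for [l = 2] and [l = 3] *)
have E0 : wp tau p1 + wp tau p2 + wp tau p3 = 0 := half_wp_sum htau.
have E0' : wp tau p2 + wp tau p1 + wp tau p3 = 0 by rewrite (addrC (wp tau p2)).
have E0'' : wp tau p3 + wp tau p1 + wp tau p2 = 0.
  by rewrite addrC (addrC (wp tau p3)) addrA E0'.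
have D1' := D1; have D2' := D2; have D3' := D3.
rewrite [X in - X]mulrC in D1'; rewrite [X in - X]mulrC in D2'.
rewrite [X in - X]mulrC in D3'.
set P := wp tau z + wp tau (z - p1) + wp tau (z - p2) + wp tau (z - p3)
  in S1 S2 S3.
have PE : \sum_(k' < 4) wp tau (z - omega tau k' / 2) = P.
  by rewrite !big_ord_recl big_ord0 !omegaE /= subr0; rewrite /P; ring.
have spectral_polyE (m : nat) (s : Cplx R -> Cplx R) :
    (forall x, \sum_(k' < 4) eps R m k' * wzeta tau (x - omega tau k' / 2) =
               s x + eta tau (3 - m)) ->
    spectral_poly tau m T z = derive1 (fun x => 2 * T - s x) z ^+ 2
      - 2 * derive1n 2 (fun x => 2 * T - s x) z * (2 * T - s z)
      + 4 * (3 / 4 * P + T * s z + T ^+ 2) * (2 * T - s z) ^+ 2.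
  move=> sE; have FE : F tau m T = (fun x => 2 * T - s x).
    by apply/funext => x; rewrite /F sE; ring.
  rewrite /spectral_poly FE /q PE sE; congr (_ + 4 * _ * _); ring.
have zeta_sum m x :
    \sum_(k' < 4) eps R m k' * wzeta tau (x - omega tau k' / 2) =
    eps R m 0 * wzeta tau x + eps R m 1 * wzeta tau (x - p1)
    + eps R m 2 * wzeta tau (x - p2) + eps R m 3 * wzeta tau (x - p3).
  by rewrite !big_ord_recl big_ord0 !omegaE /= subr0; ring.
have e1E : e tau 1 = wp tau p1 by rewrite /e omegaE.
have e2E : e tau 2 = wp tau p2 by rewrite /e omegaE.
have e3E : e tau 3 = wp tau p3 by rewrite /e omegaE.
have Q1 := @spectral_polyE 1%N (sigma1 tau p1 p2 p3 (0, 1)).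
have Q2 := @spectral_polyE 2%N (sigma2 tau p1 p2 p3 (1, 0)).
have Q3 := @spectral_polyE 3%N (sigma3 tau p1 p2 p3).
have {}Q1 : spectral_poly tau 1 T z =
    16 * (T ^+ 2 + wp tau p1 - wp tau p2) * (T ^+ 2 + wp tau p1 - wp tau p3).
  rewrite Q1; first exact: (spectral_identity _ N1 D2 D3 S1 S2 S3 E0).
  by move=> x; rewrite zeta_sum eta2 /eps /sigma1 /=; ring.
have {}Q2 : spectral_poly tau 2 T z =
    16 * (T ^+ 2 + wp tau p2 - wp tau p1) * (T ^+ 2 + wp tau p2 - wp tau p3).
  rewrite Q2; first exact: (spectral_identity _ N2 D1 D3' S2 S1 S3 E0').
  by move=> x; rewrite zeta_sum eta1 /eps /sigma2 /=; ring.
have {}Q3 : spectral_poly tau 3 T z =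
    16 * (T ^+ 2 + wp tau p3 - wp tau p1) * (T ^+ 2 + wp tau p3 - wp tau p2).
  rewrite Q3; first exact: (spectral_identity _ N3 D1' D2' S3 S1 S2 E0'').
  by move=> x; rewrite zeta_sum eta0 /eps /sigma3 /=; ring.
have [[-> -> ->]|[-> -> ->]|[-> -> ->]|[-> -> ->]|[-> -> ->]|[-> -> ->]] :=
  perm_eq_123 hljk; rewrite e1E e2E e3E.
- exact: Q1.
- by rewrite Q1 mulrAC.
- exact: Q2.
- by rewrite Q2 mulrAC.
- exact: Q3.
- by rewrite Q3 mulrAC.
Unshelve. all: by end_near. Qed.
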